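(* Let $K\subset\mathbb{R}^n$ be compact, $m\ge1$, $p>n$, and $F\in W^{m,p}(\mathbb{R}^n)$. Define the jet $\vec f=\{f^{(j)}\}_{|j|\le m-1}$ on $K$ by $f^{(j)}=D^jF|_K$ (continuous representatives). Then $\|M^{(m)}\vec f\|_{L^p(\mathbb{R}^n)}\lesssim\|\nabla^mF\|_{L^p(\mathbb{R}^n)}$, with a constant depending only on $n,m,p$.
   Context: $P^{(m-1)}_y\vec f(x)=\sum_{|j|\le m-1}\frac1{j!}f^{(j)}(y)(x-y)^j$ and $M^{(m)}\vec f(x)=\sup_{y,z\in K,\,y\ne z}\frac{|P^{(m-1)}_y\vec f(x)-P^{(m-1)}_z\vec f(x)|}{|x-y|^m+|x-z|^m}$. *)

(* Defs.v *)
From HB Require Import structures.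
From mathcomp Require Import all_boot all_order all_algebra.
From mathcomp Require Import all_classical all_reals all_analysis.
Set Implicit Arguments. Unset Strict Implicit. Unset Printing Implicit Defensive.
Import Order.TTheory GRing.Theory Num.Theory.
Import numFieldNormedType.Exports.
Local Open Scope classical_set_scope.
Local Open Scope ring_scope.

Section Defs.
Variable R : realType.

Definition enorm n (x : 'rV[R]_n) : R := Num.sqrt (\sum_i x ord0 i ^+ 2).

(* The Lebesgue integral on R^n of a nonnegative function, computed as the
   iterated one-dimensional Lebesgue integral (Tonelli). *)
Fixpoint iint (n : nat) : ('rV[R]_n -> \bar R) -> \bar R :=
  match n return ('rV[R]_n -> \bar R) -> \bar R with
  | 0 => fun f => f 0
  | n'.+1 => fun f =>
      (\int[@lebesgue_measure R]_x
          iint (fun y : 'rV[R]_n' => f (row_mx (\row_(_ < 1) x) y)))%E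
  end.

Definition sint n (f : 'rV[R]_n -> R) : \bar R :=
  (iint (fun x => (Num.max (f x) 0)%:E) - iint (fun x => (Num.max (- f x) 0)%:E))%E.

Definition borel_set n (A : set 'rV[R]_n) : Prop :=
  <<s [set U : set 'rV[R]_n | open U] >> A.
Definition borel_fun n (f : 'rV[R]_n -> R) : Prop :=
  forall B : set R, measurable B -> borel_set (f @^-1` B).

Definition rn_ae_eq n (f g : 'rV[R]_n -> R) : Prop :=
  exists N : set 'rV[R]_n, borel_set N /\
    iint (fun x => (\1_N x)%:E) = 0%E /\ forall x, ~ N x -> f x = g x.

Definition evec n (i : 'I_n) : 'rV[R]_n := \row_j (i == j)%:R.
Definition dpart n (s : seq 'I_n) (f : 'rV[R]_n -> R) : 'rV[R]_n -> R :=
  foldr (fun i g => 'D_(evec i) g) f s.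

Definition test_fun n (phi : 'rV[R]_n -> R) : Prop :=
  (forall (s : seq 'I_n), continuous (dpart s phi) /\
     forall (i : 'I_n) x, derivable (dpart s phi) x (evec i)) /\
  exists C : set 'rV[R]_n, compact C /\ forall x, ~ C x -> phi x = 0.

Definition Lp n (p : R) (f : 'rV[R]_n -> R) : Prop :=
  borel_fun f /\ (iint (fun x => (`|f x| `^ p)%:E) < +oo)%E.

(* F lies in W^{m,p}(R^n), with weak derivatives G s (s : list of coordinate
   directions, |s| <= m, so that G s = D^{s} F); G [::] is F itself. *)
Definition weak_sobolev n (m : nat) (p : R) (F : 'rV[R]_n -> R)
    (G : seq 'I_n -> 'rV[R]_n -> R) : Prop :=
  G [::] = F /\
  forall s : seq 'I_n, (size s <= m)%N ->
    Lp p (G s) /\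
    forall phi, test_fun phi ->
      sint (fun x => F x * dpart s phi x) =
      (((-1) ^+ size s)%:E * sint (fun x => (G s x * phi x)%R))%E.

Definition mindex n m := {ffun 'I_n -> 'I_m.+1}.
Definition morder n m (a : mindex n m) : nat := (\sum_i (a i : nat))%N.
Definition mseq n m (a : mindex n m) : seq 'I_n :=
  flatten [seq nseq (a i) i | i <- enum 'I_n].
Definition mfact n m (a : mindex n m) : nat := (\prod_i (a i)`!)%N.
Definition mpow n m (a : mindex n m) (x : 'rV[R]_n) : R :=
  \prod_i x ord0 i ^+ a i.

(* Taylor polynomial P^{(m-1)}_y f(x) of the jet f = (f^(j))_{|j|<=m-1},
   f^(j) = jet (mseq j). *)
Definition taylor n m (jet : seq 'I_n -> 'rV[R]_n -> R) (y x : 'rV[R]_n) : R :=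
  \sum_(a : mindex n m.-1 | (morder a <= m.-1)%N)
     (mfact a)%:R^-1 * jet (mseq a) y * mpow a (x - y).

(* M^{(m)} f(x) = sup_{y,z in K, y <> z} |P_y f(x) - P_z f(x)| /
   (|x-y|^m + |x-z|^m) (sup of the empty family taken as 0). *)
Definition Mop n m (K : set 'rV[R]_n) (jet : seq 'I_n -> 'rV[R]_n -> R)
    (x : 'rV[R]_n) : \bar R :=
  ereal_sup ([set 0%E] `|`
    [set e | exists y z, [/\ K y, K z, y <> z &
       e = ((`|taylor m jet y x - taylor m jet z x|
             / (enorm (x - y) ^+ m + enorm (x - z) ^+ m))%:E)]]).

End Defs.

(* Main.v *)
Require Import Defs.
From HB Require Import structures.
From mathcomp Require Import all_boot all_order all_algebra.
From mathcomp Require Import all_classical all_reals all_analysis.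
From mathcomp Require Import measurable_realfun.
From mathcomp Require Import ring lra.
Import Order.TTheory GRing.Theory Num.Theory.
Import numFieldNormedType.Exports.
Set Implicit Arguments. Unset Strict Implicit. Unset Printing Implicit Defensive.
Local Open Scope classical_set_scope.
Local Open Scope ring_scope.

(** Fix [x] and put [h u := P_u f(x)].  Differentiating the Taylor polynomial in
    its base point telescopes: the weak gradient of [h] involves only the
    derivatives of order [m] of [F], times [(x - u)^a] with [|a| = m - 1].  The
    claim is thus a first-order Morrey estimate for [h].

    Let [A(c, r)] be the average of [h] against a tensor bump at scale [r] about
    [c].  Exchanging bumps one coordinate at a time writes [A(c', r) - A(c, 2r)]
    as a sum of integrals of [h] against partial derivatives of test functions,
    hence bounds it by [r^(1-n)] times the integral of [|grad h|] over a cube.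
    Along a dyadic sequence of cubes shrinking from a cube about [x] to [y] these
    bounds form a geometric series, because the maximal function of
    [|nabla^m F|^q] with [n < q < p] controls the integrals over all those cubes.
    Hence [M^(m) f <= C (M (|nabla^m F|^q))^(1/q)], and the Hardy-Littlewood
    theorem in [L^(p/q)] concludes.

    Only tensor products of one-variable test functions occur, for which partial
    derivatives commute by inspection. *)

(** * Borel sets and Lebesgue measure on [R^n] *)

Section BorelRn.
Variable R : realType.

(** The exponent [q] is squeezed from both sides: [q > n] makes the ratio [2^(n/q) / 2] of the
    geometric series smaller than 1, and [q < p] gives [p/q > 1], the range of the strong maximal
    theorem.

    [P_y] and [P_z] are never compared directly. Both are compared with one average of [h] over the
    cube of half-side [2r] about [x], where [r] is the larger of [|x - y|] and [|x - z|]. The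
    resulting bound is a multiple of [r^m], which the denominator of the quotient dominates.

    No pointwise derivative of [h] is taken: only pairings with tensors occur, and a Taylor monomial
    in the base point is itself a tensor, so it can be absorbed into the test function.

    The integral of the statement is an iterated one-dimensional integral, so it is first
    identified, for measurable nonnegative functions, with the integral against a measure [mun]. The
    supremum [Mop] is handled by monotonicity of the iterated integral, which holds for arbitrary
    nonnegative functions.

    Balls of row vectors are sup-norm cubes. From the Taylor part on, the order of the statement is
    written [m.+1], so that [m] is the degree of the polynomials. *)

Definition borelRn n := g_sigma_algebraType [set U : set 'rV[R]_n | open U].

Lemma measurable_open n (U : set 'rV[R]_n) :
  open U -> measurable (U : set (borelRn n)).
Proof. by move=> oU; exact: sub_sigma_algebra. Qed.

Lemma measurable_rVball n (x : 'rV[R]_n) r :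
  measurable (ball x r : set (borelRn n)).
Proof. by apply: measurable_open; exact: ball_open. Qed.

Definition ratrv n (c : 'rV[rat]_n) : 'rV[R]_n := map_mx ratr c.

Lemma ratrv_dense n (x : 'rV[R]_n) (e : R) : 0 < e ->
  exists c, ball (ratrv c) e x.
Proof.
move=> e0.
have /choice[c cP] (j : 'I_n) : exists q : rat, `|ratr q - x ord0 j| < e.
  have /rat_in_itvoo[q] : x ord0 j - e < x ord0 j by rewrite ltrBlDr ltrDl.
  rewrite in_itv/= => /andP[q1 q2]; exists q.
  by rewrite ltr_distl q1/= (lt_trans q2)// ltrDl.
exists (\row_j c j); split=> // i j.
by rewrite ord1 /ball/= !mxE.
Qed.

Lemma open_rat_balls n (U : set 'rV[R]_n) : open U ->
  U = \bigcup_(z : 'rV[rat]_n * rat)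
        (if `[< ball (ratrv z.1) (ratr z.2) `<=` U >]
         then ball (ratrv z.1) (ratr z.2) else set0).
Proof.
move=> oU; apply/seteqP; split=> [x Ux|x [z _]]; last first.
  by case: ifPn => // /asboolP; apply.
have /nbhs_ballP[e /= e0 eU] : nbhs x U by exact: open_nbhs_nbhs.
have /rat_in_itvoo[q] : (0 : R) < e / 2 by rewrite divr_gt0.
rewrite in_itv/= => /andP[q0 qe].
have [c cx] := ratrv_dense x q0.
exists (c, q) => //=; rewrite ifT//; apply/asboolP => y cy.
apply: eU; apply: (@le_ball _ _ _ (ratr q + ratr q)); last first.
  by apply: ball_triangle cy; exact: ball_sym.
by rewrite (splitr e) lerD// ltW.
Qed.

Lemma measurable_fun_coord n (i : 'I_n) :
  measurable_fun setT (fun x : borelRn n => (x : 'rV[R]_n) ord0 i).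
Proof.
apply: (measurability _ (measurable_realfun.RGenOpens.measurableE R)) => _ [_ [a [b ->]] <-].
rewrite setTI; apply: measurable_open; apply: open_comp.
  by move=> x _; exact: coord_continuous.
exact: interval_open.
Qed.

(** The Borel sets of [R^n] are generated by coordinates: an open set is a countable union of
    rational cubes, and a cube is a finite intersection of coordinate preimages. *)
Lemma measurable_fun_rV d (T : measurableType d) n (f : T -> borelRn n) :
  (forall i, measurable_fun setT (fun t => (f t : 'rV[R]_n) ord0 i)) ->
  measurable_fun setT f.
Proof.
move=> mf; apply: (@measurability _ _ T (borelRn n) setT f [set U | open U] erefl) => _ [U oU <-].
rewrite setTI (open_rat_balls oU) preimage_bigcup.
apply: countable_bigcupT_measurable => // z.
case: ifPn => _; last by rewrite preimage_set0.
have [r0|r0] := ltP 0 (ratr z.2 : R); last first.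
  rewrite (_ : _ @^-1` _ = set0)//; apply/seteqP; split=> // x [].
  by rewrite ltNge r0.
rewrite (_ : _ @^-1` _ = \bigcap_(i in [set: 'I_n])
    ((fun t => (f t : 'rV[R]_n) ord0 i) @^-1`
       ball (ratrv z.1 ord0 i) (ratr z.2 : R))).
  apply: fin_bigcap_measurable => // i _.
  rewrite -[X in measurable X]setTI; apply: mf => //.
  exact: measurable_ball.
apply/seteqP; split=> [x [_ fx] i _|x fx]; first exact: fx.
by split=> // i j; rewrite ord1; exact: fx.
Qed.

Definition consv n (z : measurableTypeR R * borelRn n) : borelRn n.+1 :=
  (row_mx (\row_(_ < 1) z.1) (z.2 : 'rV[R]_n) : 'rV[R]_(1 + n)).

Lemma consv0 n (z : measurableTypeR R * borelRn n) : (consv z : 'rV[R]_n.+1) ord0 ord0 = z.1.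
Proof.
have -> : (ord0 : 'I_n.+1) = lshift n (ord0 : 'I_1) by exact: val_inj.
by apply: etrans (row_mxEl _ _ _ _) _; rewrite mxE.
Qed.

Lemma consvS n (z : measurableTypeR R * borelRn n) (i : 'I_n) :
  (consv z : 'rV[R]_n.+1) ord0 (lift ord0 i) = (z.2 : 'rV[R]_n) ord0 i.
Proof.
have -> : lift ord0 i = rshift 1 i by exact: val_inj.
exact: row_mxEr.
Qed.

Lemma measurable_consv n : measurable_fun setT (@consv n).
Proof.
apply: measurable_fun_rV => i.
have [->|[j ->]] : i = ord0 \/ exists j, i = lift ord0 j.
  by case: (unliftP ord0 i) => [j|] ->; [right; exists j|left].
  rewrite (_ : (fun t => _) = fst); first exact: measurable_fst.
  by apply/funext => z; rewrite consv0.
rewrite (_ : (fun t => _) = (fun x : borelRn n => (x : 'rV[R]_n) ord0 j) \o snd).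
  exact: measurableT_comp (measurable_fun_coord j) _.
by apply/funext => z; rewrite consvS.
Qed.

Definition splitv n (x : borelRn n.+1) : measurableTypeR R * borelRn n :=
  ((x : 'rV[R]_n.+1) ord0 ord0, \row_i (x : 'rV[R]_n.+1) ord0 (lift ord0 i)).

Lemma consvK n : cancel (@consv n) (@splitv n).
Proof.
move=> z; rewrite /splitv consv0 [RHS]surjective_pairing; congr pair.
by apply/rowP => i; rewrite mxE consvS.
Qed.

Lemma measurable_splitv n : measurable_fun setT (@splitv n).
Proof.
apply/measurable_fun_pairP; split; first exact: measurable_fun_coord.
apply: measurable_fun_rV => i.
rewrite (_ : (fun t => _) =
    (fun x : borelRn n.+1 => (x : 'rV[R]_n.+1) ord0 (lift ord0 i))).
  exact: measurable_fun_coord.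
by apply/funext => x; rewrite mxE.
Qed.

(** Pushing the product measure forward along [consv] keeps the carrier equal to row vectors with
    their Borel sets. Sigma-finiteness is recorded because the next product, and Tonelli for it,
    require it. *)
Definition consm n (m : {sigma_finite_measure set (borelRn n) -> \bar R}) :=
  pushforward (@lebesgue_measure R \x m)%E (@consv n).

HB.instance Definition _ n (m : {sigma_finite_measure set (borelRn n) -> \bar R}) :=
  Measure.copy (consm m)
    (measure_function_pushforward__canonical__measure_function_Measure
       (@lebesgue_measure R \x m)%E (@measurable_consv n)).

Lemma sigma_finite_consm n (m : {sigma_finite_measure set (borelRn n) -> \bar R}) :
  sigma_finite setT (consm m).
Proof.
have /sigma_finiteP[F [FT ndF Foo]] := sigma_finiteT m.
pose I k : set (measurableTypeR R) := `[- k%:R, k%:R]%classic.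
have mI k : measurable (I k `*` F k).
  by apply: measurableX; [exact: measurable_itv|have [] := Foo k].
exists (fun k => @splitv n @^-1` (I k `*` F k)).
  apply/seteqP; split=> // x _.
  have [k _ kx] : (\bigcup_i F i) (splitv x).2 by rewrite -FT.
  exists (maxn k (Num.bound `|(splitv x).1|)) => //; split; last first.
    have /subsetPset := ndF _ _ (leq_maxl k (Num.bound `|(splitv x).1|)).
    exact.
  rewrite /I /= in_itv/= -ler_norml (le_trans (ltW (archi_boundP (normr_ge0 _))))//.
  by rewrite ler_nat leq_max leqnn orbT.
move=> k; split.
  by rewrite -[X in measurable X]setTI; apply: measurable_splitv => //; exact: mI.
rewrite /consm /pushforward -comp_preimage (_ : _ \o _ = id) ?preimage_id//.
  have [mFk Fk] := Foo k.
  rewrite product_measure1E//; last exact: measurable_itv.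
  have Ik : (@lebesgue_measure R (I k) < +oo)%E.
    by rewrite lebesgue_measure_itv/=; case: ifP => // _; rewrite -EFinD ltry.
  by rewrite lte_mul_pinfty ?ge0_fin_numE.
by apply/funext => z; exact: consvK.
Qed.

HB.instance Definition _ n (m : {sigma_finite_measure set (borelRn n) -> \bar R}) :=
  Measure_isSigmaFinite.Build _ _ _ (consm m) (sigma_finite_consm m).

(** The recursion follows that of [iint], so that Tonelli at each stage identifies the two
    integrals. *)
Fixpoint mun n : {sigma_finite_measure set (borelRn n) -> \bar R} :=
  match n with
  | 0 => \d_ ((0 : 'rV[R]_0) : borelRn 0)
  | n'.+1 => consm (mun n')
  end.

Lemma mun_consm n : mun n.+1 = consm (mun n) :> (set (borelRn n.+1) -> \bar R).
Proof. by []. Qed.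

Lemma integral_consm n (m : {sigma_finite_measure set (borelRn n) -> \bar R})
    (f : borelRn n.+1 -> \bar R) :
  measurable_fun setT f -> (forall x, 0 <= f x)%E ->
  (\int[consm m]_x f x = \int[@lebesgue_measure R]_t \int[m]_y f (consv (t, y)))%E.
Proof.
move=> mf f0.
have := @ge0_integral_pushforward _ _ _ _ _ _ (@measurable_consv n)
  (@lebesgue_measure R \x m)%E setT f measurableT mf (in1W f0).
rewrite preimage_setT => ->.
rewrite fubini_tonelli1//.
  by apply: measurableT_comp => //; exact: measurable_consv.
by move=> z; exact: f0.
Qed.

Lemma integral_munS n (f : borelRn n.+1 -> \bar R) :
  measurable_fun setT f -> (forall x, 0 <= f x)%E ->
  (\int[mun n.+1]_x f x =
   \int[@lebesgue_measure R]_t \int[mun n]_y f (consv (t, y)))%E.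
Proof. exact: integral_consm. Qed.

Lemma iintE n (f : 'rV[R]_n -> \bar R) :
  measurable_fun setT (f : borelRn n -> \bar R) -> (forall x, 0 <= f x)%E ->
  iint f = (\int[mun n]_x f x)%E.
Proof.
elim: n f => [|n IH] f mf f0.
  by rewrite /= integral_dirac// diracT mul1e.
rewrite integral_munS//=; apply: eq_integral => t _.
rewrite IH//; apply: (measurableT_comp mf).
have /measurable_fun_pair2 := @measurable_consv n; exact.
Qed.

(** Measurability is not assumed: the integral of a nonnegative function is a supremum over the
    simple functions below it, and a larger function admits more of them. This is what allows [Mop]
    to be integrated. *)
Lemma ge0_le_integralW d (T : measurableType d) (mu : {measure set T -> \bar R})
    (f g : T -> \bar R) : (forall x, 0 <= f x)%E -> (forall x, f x <= g x)%E ->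
  (\int[mu]_x f x <= \int[mu]_x g x)%E.
Proof.
move=> f0 fg.
have g0 x : (0 <= g x)%E by exact: le_trans (fg x).
rewrite !ge0_integralTE//; apply: le_ereal_sup => _ [h hf <-].
by exists h => // x; rewrite (le_trans (hf x)).
Qed.

Lemma le_iint n (f g : 'rV[R]_n -> \bar R) :
  (forall x, 0 <= f x)%E -> (forall x, f x <= g x)%E -> (0 <= iint f <= iint g)%E.
Proof.
elim: n f g => [|n IH] f g f0 fg /=; first by rewrite f0 fg.
have H t := IH (fun y => f (consv (t, y))) (fun y => g (consv (t, y)))
  (fun y => f0 _) (fun y => fg _).
rewrite integral_ge0/=; last by move=> t _; case/andP: (H t).
by apply: ge0_le_integralW => t; case/andP: (H t).
Qed.

Lemma mun_ball n (x : 'rV[R]_n) r : 0 < r ->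
  mun n (ball x r : set (borelRn n)) = (((2 * r) ^+ n)%:E)%E.
Proof.
move=> r0; elim: n x => [|n IH] x.
  by rewrite expr0 /= diracE mem_set//; split=> // i [].
rewrite mun_consm /consm /pushforward.
rewrite (_ : _ @^-1` _ = (ball ((splitv x).1 : R) r : set (measurableTypeR R)) `*` ball ((splitv x).2 : 'rV[R]_n) r).
  rewrite product_measure1E; [|exact: measurable_ball|exact: measurable_rVball].
  transitivity ((r *+ 2)%:E * ((2 * r) ^+ n)%:E)%E.
    by congr (_ * _)%E; [exact: lebesgue_measure_ball (ltW r0)|exact: IH].
  by rewrite -EFinM exprS mulr_natl.
apply/seteqP; split=> [[t y] [_ xr]|[t y] [/= xt [_ xy]]].
  split=> /=; first by have := xr ord0 ord0; rewrite consv0.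
  split=> // i j; have := xr ord0 (lift ord0 j).
  by rewrite consvS (ord1 i) mxE.
split=> // i j; rewrite ord1; case: (unliftP ord0 j) => [k|] ->.
  by rewrite consvS; have := xy ord0 k; rewrite !mxE.
by rewrite consv0.
Qed.

End BorelRn.

(** * The Hardy-Littlewood maximal function *)

Section Maximal.
Variables (R : realType) (n : nat).
Local Notation rv := 'rV[R]_n.
Local Notation mu := (mun R n).
Implicit Types (v : rv -> R) (x : rv).

Definition ballint v x (r : R) : \bar R :=
  (\int[mu]_(u in (ball x r : set (borelRn R n))) (v u)%:E)%E.

(* The supremum runs over the countably many rational cubes containing [x], so
   that superlevel sets are countable unions of cubes. *)
Definition maxfun v x : \bar R :=
  ereal_sup [set e | exists z : 'rV[rat]_n * rat,
    [/\ 0 < ratr z.2 :> R, ball (ratrv R z.1) (ratr z.2) x &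
        e = (((2 * ratr z.2) ^+ n)^-1%:E * ballint v (ratrv R z.1) (ratr z.2))%E]].

Definition measnneg v := measurable_fun setT (v : borelRn R n -> R) /\ forall u, 0 <= v u.

Lemma ballint_ge0 v x r : measnneg v -> (0 <= ballint v x r)%E.
Proof. by move=> [_ v0]; apply: integral_ge0 => u _; rewrite lee_fin. Qed.

Lemma maxfun_ge0 v x : measnneg v -> (0 <= maxfun v x)%E.
Proof.
move=> mv; have [c cx] := ratrv_dense x ltr01.
have : (0 <= (((2 * ratr 1) ^+ n)^-1%:E * ballint v (ratrv R c) (ratr 1%Q)))%E.
  by rewrite mule_ge0 ?ballint_ge0// lee_fin invr_ge0 exprn_ge0// rmorph1.
move=> /le_trans; apply; apply: ereal_sup_ubound; exists (c, 1%Q) => /=.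
by rewrite rmorph1; split.
Qed.

Lemma le_ballint v x y r s : measnneg v -> ball x r `<=` ball y s ->
  (ballint v x r <= ballint v y s)%E.
Proof.
move=> [mv v0] xy; apply: ge0_subset_integral => //.
- exact: measurable_rVball.
- exact: measurable_rVball.
- by apply/measurable_EFinP; apply: measurable_funS mv.
- by move=> u _; rewrite lee_fin.
Qed.

(** The factor 4 is the price of rational cubes: a rational radius between [r] and [2 * r], with a
    rational centre close enough to [x], gives an admissible cube that contains [ball x r] and has
    side at most [4 * r]. *)
Lemma ballint_le_maxfun v x r : measnneg v -> 0 < r ->
  (ballint v x r <= ((4 * r) ^+ n)%:E * maxfun v x)%E.
Proof.
move=> mv r0.
have /rat_in_itvoo[q] : r < 2 * r by rewrite ltr_pMl// ltr1n.
rewrite in_itv/= => /andP[rq qr].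
have q0 : 0 < ratr q :> R by exact: lt_trans rq.
have [c cx] : exists c, ball (ratrv R c) (ratr q - r) x.
  by apply: ratrv_dense; rewrite subr_gt0.
have cxq : ball (ratrv R c) (ratr q) x.
  by apply: le_ball cx; rewrite gerBl ltW.
apply: (@le_trans _ _ (ballint v (ratrv R c) (ratr q))).
  apply: le_ballint => // u xu.
  by rewrite -(subrK r (ratr q)); exact: ball_triangle xu.
apply: (@le_trans _ _ (((2 * ratr q) ^+ n)%:E * maxfun v x))%E; last first.
  rewrite lee_wpmul2r ?maxfun_ge0// lee_fin lerXn2r ?nnegrE//; set t := ratr q in q0 qr *; lra.
have q20 : 0 < (2 * ratr q) ^+ n :> R by apply/exprn_gt0/mulr_gt0.
rewrite -lee_pdivrMl//.
by apply: ereal_sup_ubound; exists (c, q).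
Qed.

Definition Oset v (l : R) : set (borelRn R n) := [set x | (l%:E < maxfun v x)%E].

Definition Oball v l (z : 'rV[rat]_n * rat) : set (borelRn R n) :=
  if `[< 0 < ratr z.2 :> R /\ (l%:E <
     ((2 * ratr z.2) ^+ n)^-1%:E * ballint v (ratrv R z.1) (ratr z.2))%E >]
  then ball (ratrv R z.1) (ratr z.2) else set0.

Lemma OsetE v l : Oset v l = \bigcup_z Oball v l z.
Proof.
apply/seteqP; split=> [x /ereal_sup_gt[_ [z [z0 zx ->]] zl]|x [z _]].
  by exists z => //; rewrite /Oball ifT//; apply/asboolP.
rewrite /Oball; case: ifPn => // /asboolP[z0 zl] zx.
by apply: (lt_le_trans zl); apply: ereal_sup_ubound; exists z.
Qed.

Lemma measurable_Oball v l z : measurable (Oball v l z).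
Proof. by rewrite /Oball; case: ifPn => // _; exact: measurable_rVball. Qed.

Lemma measurable_Oset v l : measurable (Oset v l).
Proof.
rewrite OsetE; apply: countable_bigcupT_measurable => // z.
exact: measurable_Oball.
Qed.

Lemma measurable_maxfun v : measurable_fun setT (maxfun v : borelRn R n -> \bar R).
Proof.
apply: (measurability _ (ErealGenOInfty.measurableE R)) => _ [_ [l ->] <-].
rewrite setTI (_ : _ @^-1` _ = Oset v l); first exact: measurable_Oset.
by apply/seteqP; split=> x; rewrite /Oset/= in_itv/= andbT.
Qed.

Lemma seq_max_radius (s : seq (rv * R)) : s != [::] ->
  exists2 b, b \in s & forall b', b' \in s -> b'.2 <= b.2.
Proof.
elim: s => // b s IH _; have [->|/IH[b1 b1s b1P]] := eqVneq s [::].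
  by exists b; rewrite ?inE// => b'; rewrite inE => /eqP->.
have [b12|b12] := leP b.2 b1.2.
  by exists b1; rewrite ?inE ?b1s ?orbT// => b'; rewrite inE => /predU1P[->//|/b1P].
exists b; rewrite ?inE ?eqxx// => b'; rewrite inE => /predU1P[->//|/b1P].
by move=> /le_trans; apply; exact: ltW.
Qed.

Definition ballsU (s : seq (rv * R)) : set (borelRn R n) :=
  [set x | exists2 b, b \in s & ball b.1 b.2 (x : rv)].

Lemma ballsU_cons b s : ballsU (b :: s) = ball b.1 b.2 `|` ballsU s.
Proof.
apply/seteqP; split=> [x [b']|x [bx|[b' b's b'x]]].
- by rewrite inE => /predU1P[->|b's] b'x; [left|right; exists b'].
- by exists b; rewrite // mem_head.
- by exists b' => //; rewrite inE b's orbT.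
Qed.

Lemma measurable_ballsU s : measurable (ballsU s).
Proof.
elim: s => [|b s IH].
  by rewrite (_ : ballsU _ = set0)//; apply/seteqP; split=> // x [b].
by rewrite ballsU_cons; apply: measurableU => //; exact: measurable_rVball.
Qed.

(* Vitali's selection: keep a largest ball [b], drop the balls meeting it (they
   lie in [3b]), and recurse on the balls disjoint from [b]. *)
Lemma vitali_weak v l s : measnneg v -> 0 < l ->
  (forall b, b \in s -> 0 < b.2 /\
     (l%:E * mu (ball b.1 b.2 : set (borelRn R n)) <= ballint v b.1 b.2)%E) ->
  (mu (ballsU s) <= (3 ^+ n / l)%:E * \int[mu]_(u in ballsU s) (v u)%:E)%E.
Proof.
move=> [mv v0] l0; have [k] := ubnP (size s).
elim: k s => // k IH s; rewrite ltnS => sk sP.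
have [s0|/seq_max_radius[b bs bmax]] := eqVneq s [::].
  rewrite s0 (_ : ballsU _ = set0) ?measure0 ?integral_set0 ?mule0//.
  by apply/seteqP; split=> // x [b].
pose meets b' := `[< ball b'.1 b'.2 `&` ball b.1 b.2 !=set0 >].
pose s' := [seq b' <- s | ~~ meets b'].
have [b0 lb] := sP _ bs.
have meetsb : meets b by apply/asboolP; exists b.1; split; exact: ballxx.
have s'k : (size s' < k)%N.
  rewrite (leq_trans _ sk)// size_filter.
  rewrite -(count_predC (fun b' => ~~ meets b') s) -[X in (X < _)%N]addn0 ltn_add2l.
  by rewrite -has_count; apply/hasP; exists b => //=; rewrite negbK.
have s'P b' : b' \in s' -> 0 < b'.2 /\
     (l%:E * mu (ball b'.1 b'.2 : set (borelRn R n)) <= ballint v b'.1 b'.2)%E.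
  by rewrite mem_filter => /andP[_ /sP].
have mEv (D : set (borelRn R n)) :
    measurable_fun D (fun u : borelRn R n => (v u)%:E).
  by apply/measurable_EFinP; exact: measurable_funS mv.
have sub1 : ballsU s `<=` ball b.1 (3 * b.2) `|` ballsU s'.
  move=> x [b' b's b'x]; have [/asboolP[y [b'y by_]]|nb'] := boolP (meets b').
    left; have -> : 3 * b.2 = b.2 + (b.2 + b.2) by ring.
    apply: ball_triangle by_ _; apply: ball_triangle.
      apply: ball_sym; apply: le_ball (bmax _ b's) _ b'y.
    exact: le_ball (bmax _ b's) _ b'x.
  by right; exists b'; rewrite // mem_filter nb'.
have sub2 : ball b.1 b.2 `|` ballsU s' `<=` ballsU s.
  move=> x [bx|[b']]; first by exists b.
  by rewrite mem_filter => /andP[_ b's] b'x; exists b'.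
have dis : [disjoint (ball b.1 b.2 : set (borelRn R n)) & ballsU s'].
  apply/disj_setPS => x [bx [b']]; rewrite mem_filter => /andP[/asboolP nb' _] b'x.
  by apply: nb'; exists x.
apply: (@le_trans _ _ (mu (ball b.1 (3 * b.2) : set (borelRn R n)) + mu (ballsU s')))%E.
  apply: (le_trans _ (measureU2 _ _ _)).
  - apply: le_measure sub1; rewrite inE; first exact: measurable_ballsU.
    by apply: measurableU; [exact: measurable_rVball|exact: measurable_ballsU].
  - exact: measurable_rVball.
  - exact: measurable_ballsU.
apply: (@le_trans _ _ ((3 ^+ n / l)%:E * (ballint v b.1 b.2 +
    \int[mu]_(u in ballsU s') (v u)%:E)))%E; last first.
  apply: lee_wpmul2l; first by rewrite lee_fin divr_ge0 ?exprn_ge0 ?ltW.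
  rewrite /ballint -ge0_integral_setU//; last 3 first.
  - exact: measurable_rVball.
  - exact: measurable_ballsU.
  - by move=> u _; rewrite lee_fin.
  apply: ge0_subset_integral => //.
  - by apply: measurableU; [exact: measurable_rVball|exact: measurable_ballsU].
  - exact: measurable_ballsU.
  - by move=> u _; rewrite lee_fin.
rewrite ge0_muleDr ?ballint_ge0//; last by apply: integral_ge0 => u _; rewrite lee_fin.
apply: leeD; last exact: IH.
move: lb; rewrite !mun_ball ?mulr_gt0// -EFinM => lb.
rewrite (_ : (2 * (3 * b.2)) ^+ n = 3 ^+ n / l * (l * (2 * b.2) ^+ n)); last first.
  by rewrite mulrCA exprMn mulrA divfK// gt_eqF.
by rewrite EFinM lee_wpmul2l// lee_fin divr_ge0 ?exprn_ge0 ?ltW.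
Qed.

(** The selection argument treats finite families only. The countably many cubes are enumerated by
    [unpickle], and the finite unions [ballsU (s k)] exhaust the superlevel set from below. *)
Lemma maxfun_weak v l : measnneg v -> 0 < l ->
  (mu (Oset v l) <= (3 ^+ n / l)%:E * \int[mu]_u (v u)%:E)%E.
Proof.
move=> mv l0; have [mv' v0] := mv.
pose cond (z : 'rV[rat]_n * rat) := `[< 0 < ratr z.2 :> R /\ (l%:E <
   ((2 * ratr z.2) ^+ n)^-1%:E * ballint v (ratrv R z.1) (ratr z.2))%E >].
pose f i := if unpickle i is Some z then
  if cond z then Some (ratrv R z.1, ratr z.2 : R) else None else None.
pose s k := pmap f (iota 0 k).
have sP k b : (b \in s k) <-> exists2 i, (i < k)%N & f i = Some b.
  rewrite /s mem_pmap; split=> [/mapP[i]|[i ik fi]].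
    by rewrite mem_iota add0n => ik ->; exists i.
  by apply/mapP; exists i; rewrite ?fi// mem_iota.
have OsE : Oset v l = \bigcup_k ballsU (s k).
  rewrite OsetE; apply/seteqP; split=> [x [z _]|x [k _ [b /sP[i ik]]]].
    rewrite /Oball; case: ifPn => // cz zx; exists (pickle z).+1 => //.
    exists (ratrv R z.1, ratr z.2) => //; apply/sP; exists (pickle z) => //.
    by rewrite /f pickleK /cond cz.
  rewrite /f; case: unpickle => // z; case: ifPn => // cz [<-] zx.
  by exists z => //; rewrite /Oball [X in if X then _ else _]cz.
have nds : {homo (fun k => ballsU (s k)) : n m / (n <= m)%N >-> (n <= m)%O}.
  move=> i j ij; apply/subsetPset => x [b /sP[k ki kb] bx].
  by exists b => //; apply/sP; exists k => //; exact: leq_trans ij.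
have cv := @nondecreasing_cvg_mu _ _ _ mu _ (fun k => measurable_ballsU (s k))
  (bigcupT_measurable _ (fun k => measurable_ballsU (s k))) nds.
rewrite OsE -(cvg_lim _ cv)//; apply: lime_le; first by apply/cvg_ex; eexists; exact: cv.
apply: nearW => k /=; apply: (@le_trans _ _ ((3 ^+ n / l)%:E *
    \int[mu]_(u in ballsU (s k)) (v u)%:E))%E; last first.
  apply: lee_wpmul2l; first by rewrite lee_fin divr_ge0 ?exprn_ge0 ?ltW.
  apply: ge0_subset_integral => //; first exact: measurable_ballsU.
  - exact/measurable_EFinP.
  - by move=> u _; rewrite lee_fin.
apply: vitali_weak => // b /sP[i _]; rewrite /f; case: unpickle => // z.
case: ifPn => // /asboolP[z0 zl] [<-] /=; split=> //.
have z20 : 0 < (2 * ratr z.2) ^+ n :> R by apply/exprn_gt0/mulr_gt0.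
by rewrite mun_ball// muleC -lee_pdivlMl// ltW.
Qed.

Definition trunc v l : rv -> R := fun u => v u * \1_[set u | l < v u] u.

Lemma measnneg_trunc v l : measnneg v -> measnneg (trunc v l).
Proof.
move=> [mv v0]; split=> [|u]; last by rewrite mulr_ge0.
apply: measurable_funM => //; apply: measurable_indic.
rewrite -[X in measurable X]setTI.
have := mv measurableT `]l, +oo[%classic (measurable_itv _).
congr (measurable (_ `&` _)).
by apply/seteqP; split=> u /=; rewrite in_itv/= andbT.
Qed.

(** Since [v <= l + trunc v l], the part of [v] below [l] adds at most [l] to any average, so an
    average above [2 * l] leaves more than [l] to the truncation. *)
Lemma Oset_trunc v l : measnneg v -> 0 < l ->
  Oset v (2 * l) `<=` Oset (trunc v l) l.
Proof.
move=> mv l0 x; rewrite !OsetE => -[z _]; rewrite /Oball.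
case: ifPn => // /asboolP[z0 zl] zx; exists z => //.
rewrite ifT//; apply/asboolP; split=> //.
have z20 : 0 < (2 * ratr z.2) ^+ n :> R by apply/exprn_gt0/mulr_gt0.
have H : (ballint v (ratrv R z.1) (ratr z.2) <=
    (l * (2 * ratr z.2) ^+ n)%:E + ballint (trunc v l) (ratrv R z.1) (ratr z.2))%E.
  rewrite EFinM -(mun_ball (ratrv R z.1) z0) -integral_cst; last exact: measurable_rVball.
  have [mt t0] := measnneg_trunc l mv; have [mv' v0] := mv.
  rewrite /ballint -ge0_integralD//; last 4 first.
  - exact: measurable_rVball.
  - by move=> u _; rewrite lee_fin ltW.
  - by move=> u _; rewrite lee_fin.
  - by apply/measurable_EFinP; exact: measurable_funS mt.
  apply: ge0_le_integral => //.
  - exact: measurable_rVball.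
  - by move=> u _; rewrite lee_fin.
  - by apply/measurable_EFinP; exact: measurable_funS mv'.
  - apply: emeasurable_funD; first exact: measurable_cst.
    by apply/measurable_EFinP; exact: measurable_funS mt.
  move=> u _; rewrite /= -EFinD lee_fin /trunc indicE.
  have [lv|lv] := ltP l (v u); first by rewrite mem_set// mulr1 lerDr ltW.
  by rewrite memNset ?mulr0 ?addr0//= ltNge lv.
have := lt_le_trans zl (lee_wpmul2l _ H).
rewrite lee_fin invr_ge0 (ltW z20) => /(_ isT).
rewrite ge0_muleDr//; last 2 first.
- by rewrite lee_fin mulr_ge0 ?ltW.
- by apply: ballint_ge0; exact: measnneg_trunc.
rewrite -EFinM mulrCA mulVf ?gt_eqF// mulr1 (_ : 2 * l = l + l); last by ring.
by rewrite EFinD lteD2lE.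
Qed.

(** The gain over the weak bound is that only the values of [v] above [l] enter, which makes the sum
    over levels converge in [L^s]. *)
Lemma maxfun_level v l : measnneg v -> 0 < l ->
  (mu (Oset v (2 * l)) <= (3 ^+ n / l)%:E * \int[mu]_u (trunc v l u)%:E)%E.
Proof.
move=> mv l0; apply: le_trans (maxfun_weak (measnneg_trunc l mv) l0).
apply: le_measure; rewrite ?inE; [exact: measurable_Oset..|exact: Oset_trunc].
Qed.

End Maximal.

(** * The strong maximal inequality, by summing the weak bound over dyadic levels *)

Section MaximalStrong.
Variables (R : realType) (s : R).
Hypothesis s1 : 1 < s.

(** Dyadic levels beginning at [2^-N]: a discrete substitute for the layer-cake formula. All bounds
    must be uniform in [N], which tends to infinity at the end. *)
Let t N i : R := 2 ^+ i / 2 ^+ N.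
Let b : R := 2 `^ (s - 1).

Let t_gt0 N i : 0 < t N i.
Proof. by rewrite divr_gt0 ?exprn_gt0. Qed.

Let tS N i : t N i.+1 = 2 * t N i.
Proof. by rewrite /t exprS mulrA. Qed.

Let b_gt1 : 1 < b.
Proof.
rewrite /b /powR pnatr_eq0/= -[ltLHS]expR0 ltr_expR.
by rewrite mulr_gt0 ?subr_gt0 ?ln_gt0 ?ltr1n.
Qed.

(** The terms grow by the factor [b > 1], so a geometric sum is controlled by its last nonzero term,
    whose level is still below [a]. The bound depends on neither [N] nor [K]. *)
Lemma dyadic_sum N K (a : R) : 0 <= a ->
  \sum_(i < K) t N i `^ (s - 1) * (t N i < a)%R%:R <= b / (b - 1) * a `^ (s - 1).
Proof.
move=> a0; have c0 : 0 < b / (b - 1) by rewrite divr_gt0 ?subr_gt0// (lt_trans ltr01).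
have full k : \sum_(i < k.+1) t N i `^ (s - 1) <= b / (b - 1) * t N k `^ (s - 1).
  elim: k => [|k IH].
    rewrite big_ord1 -[leLHS]mul1r ler_wpM2r ?powR_ge0//.
    by rewrite ler_pdivlMr ?subr_gt0// mul1r gerBl.
  rewrite big_ord_recr/= (le_trans (lerD IH (lexx _)))//.
  rewrite tS powRM ?ler0n ?(ltW (t_gt0 _ _))// -/b le_eqVlt; apply/orP; left.
  by apply/eqP; field; rewrite subr_eq0 gt_eqF.
elim: K => [|K IH]; first by rewrite big_ord0 mulr_ge0 ?powR_ge0 ?ltW.
have [Ka|Ka] := ltP (t N K) a; last first.
  by rewrite big_ord_recr/= ltNge Ka/= mulr0 addr0.
apply: (@le_trans _ _ (\sum_(i < K.+1) t N i `^ (s - 1))).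
  by apply: ler_sum => i _; rewrite ler_piMr ?powR_ge0// lern1 leq_b1.
apply: (le_trans (full K)); rewrite ler_pM2l//.
by apply: ge0_ler_powR; rewrite ?nnegrE ?subr_ge0 ?a0//; exact: ltW.
Qed.

(** If [M] lies between [2 * t N i] and [4 * t N i], layer [i] alone pays for [M^s]. The test at the
    bottom and the minimum at the top discard the values that finitely many layers cannot see. *)
Lemma dyadic_layers N K (M : \bar R) : (0 <= M)%E ->
  ((if (2 * t N 0)%R%:E < M then poweR (mine M (2 * t N K.+1)%R%:E) s else 0) <=
   \sum_(i < K.+1) ((4 * t N i) `^ s * ((2 * t N i)%:E < M)%E%:R)%R%:E)%E.
Proof.
move=> M0; elim: K => [|K IH].
  rewrite big_ord1; case: ifPn => h; last by rewrite mulr0.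
  rewrite mulr1 -poweR_EFin gt0_ler_poweR//; first exact: ltW (lt_trans ltr01 s1).
  - rewrite in_itv/= leey andbT le_min M0/= lee_fin.
    by rewrite mulr_ge0// ltW.
  - by rewrite in_itv/= leey andbT lee_fin mulr_ge0// ltW.
  - by rewrite tS mulrA (_ : 2 * 2 = 4 :> R) ?ge_min ?lexx ?orbT//; ring.
rewrite big_ord_recr/=; have [Kl|Kl] := ltP (2 * t N K.+1)%:E M; last first.
  rewrite mulr0 adde0; congr (_ <= _)%E: IH; case: ifP => // _; congr poweR.
  rewrite !min_l//; apply: (le_trans Kl); rewrite lee_fin (tS _ K.+1).
  by rewrite ler_pM2l// ler_pMl// ler1n.
rewrite mulr1; case: ifPn => _; last first.
  by apply: adde_ge0; [apply: sume_ge0 => i _|];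
    rewrite lee_fin ?mulr_ge0 ?powR_ge0.
apply: (@le_trans _ _ ((4 * t N K.+1) `^ s)%:E); last first.
  by apply: leeDr; apply: sume_ge0 => i _; rewrite lee_fin ?mulr_ge0 ?powR_ge0.
rewrite -poweR_EFin gt0_ler_poweR//; first exact: ltW (lt_trans ltr01 s1).
- rewrite in_itv/= leey andbT le_min M0/= lee_fin.
  by rewrite mulr_ge0// ltW.
- by rewrite in_itv/= leey andbT lee_fin mulr_ge0// ltW.
- by rewrite (tS _ K.+1) mulrA (_ : 2 * 2 = 4 :> R) ?ge_min ?lexx ?orbT//; ring.
Qed.

Variable n : nat.
Local Notation mu := (mun R n).

Lemma maxfun_strong : exists2 C : R, 0 < C & forall v : 'rV[R]_n -> R, measnneg v ->
  (\int[mu]_x poweR (maxfun v x) s <= C%:E * \int[mu]_x (v x `^ s)%:E)%E.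
Proof.
(* [4^s] comes from the top of a layer, [3^n] from the covering argument, and [c] from the geometric
   sum. *)
pose c : R := b / (b - 1); pose C := 4 `^ s * 3 ^+ n * c.
have c0 : 0 < c by rewrite divr_gt0 ?subr_gt0// (lt_trans ltr01).
have C0 : 0 < C.
  by apply: mulr_gt0 => //; apply: mulr_gt0; rewrite ?exprn_gt0 ?powR_gt0.
exists C => //.
move=> v mv; have [mv' v0] := mv.
have s0 : 0 < s by exact: lt_trans s1.
(* With [2 * N] as top index the levels run from [2^-N] to the order of [2^N], so both cutoffs in
   [f N] disappear as [N] grows. *)
pose K N := (2 * N)%N.
pose f N (x : borelRn R n) := (if ((2 * t N 0)%:E < maxfun v x)
  then poweR (mine (maxfun v x) (2 * t N (K N).+1)%R%:E) s else 0)%E.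
have f0 N x : (0 <= f N x)%E by rewrite /f; case: ifP => // _; exact: poweR_ge0.
have tKE N : t N (K N).+1 = 2 * 2 ^+ N.
  by rewrite /t /K exprS mulSn mul1n exprD mulrA mulfK// expf_neq0.
have mf N : measurable_fun setT (f N).
  apply: measurable_fun_ifT => //.
    apply: (measurable_fun_bool true); rewrite setTI.
    exact: (measurable_Oset v (2 * t N 0)).
  apply: (measurableT_comp (measurable_poweR s)).
  apply: measurable_mine => //; exact: measurable_maxfun.
have ndf x : {homo f^~ x : i j / (i <= j)%N >-> (i <= j)%E}.
  move=> i j ij; rewrite /f; case: ifPn => [hi|_]; last exact: f0.
  have hij : 2 ^+ i <= 2 ^+ j :> R by rewrite ler_eXn2l// ltr1n.
  rewrite ifT; last first.
    apply: le_lt_trans hi; rewrite lee_fin ler_pM2l// /t !expr0 ler_pM2l//.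
    by rewrite lef_pV2 ?posrE ?exprn_gt0.
  rewrite gt0_ler_poweR//; first exact: ltW.
  - rewrite in_itv/= leey andbT le_min maxfun_ge0//= lee_fin.
    by rewrite mulr_ge0// ltW.
  - rewrite in_itv/= leey andbT le_min maxfun_ge0//= lee_fin.
    by rewrite mulr_ge0// ltW.
  - rewrite le_min2// lee_fin !tKE ler_pM2l// ler_pM2l//.
(* By [maxfun_level], layer [i] costs at most [4^s * 3^n * t^(s-1)] times the integral of [v] over
   the set where [v > t]. After exchanging sum and integral, [dyadic_sum] at [a = v x] turns the sum
   over [i] into [v x * (v x)^(s-1)]. *)
have fle N : (\int[mu]_x f N x <= C%:E * \int[mu]_x (v x `^ s)%:E)%E.
  apply: (@le_trans _ _ (\int[mu]_x (\sum_(i < (K N).+1)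
      ((4 * t N i) `^ s)%:E * (\1_(Oset v (2 * t N i)) x)%:E)))%E.
    apply: ge0_le_integralW => // x.
    apply: (le_trans (dyadic_layers N (K N) (maxfun_ge0 x mv))).
    apply: lee_sum => i _; rewrite -EFinM lee_fin indicE; set B := (_ < _)%E.
    by rewrite (_ : (x \in _) = B)//; apply/idP/idP; rewrite inE.
  rewrite ge0_integral_sum//; last 2 first.
  - move=> i; apply: measurable_funeM; apply/measurable_EFinP.
    by apply: measurable_indic; exact: measurable_Oset.
  - by move=> i x _; rewrite mule_ge0// lee_fin ?powR_ge0.
  apply: (@le_trans _ _ (\sum_(i < (K N).+1) \int[mu]_x
    ((4 `^ s * 3 ^+ n)%:E * (t N i `^ (s - 1) * trunc v (t N i) x)%:E)))%E.
    apply: lee_sum => i _; rewrite ge0_integralZl//; last 2 first.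
    - by apply/measurable_EFinP; apply: measurable_indic; exact: measurable_Oset.
    - by rewrite lee_fin powR_ge0.
    rewrite integral_indic//; last exact: measurable_Oset.
    rewrite setIT (le_trans (lee_wpmul2l _ (maxfun_level mv (t_gt0 N i))))//.
      by rewrite lee_fin powR_ge0.
    rewrite muleA -EFinM [leRHS](eq_integral (fun x : borelRn R n => ((4 `^ s * 3 ^+ n * t N i `^ (s - 1))%:E
       * (trunc v (t N i) x)%:E)%E)); last first.
      by move=> x _; rewrite -!EFinM; congr EFin; ring.
    have [mt tr0] := measnneg_trunc (t N i) mv.
    rewrite ge0_integralZl//; last 3 first.
    - exact/measurable_EFinP.
    - by move=> x _; rewrite lee_fin.
    - by rewrite lee_fin !mulr_ge0 ?powR_ge0 ?exprn_ge0.
    rewrite lee_wpmul2r//; first by apply: integral_ge0 => x _; rewrite lee_fin.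
    rewrite lee_fin powRM ?ler0n ?(ltW (t_gt0 _ _))//.
    rewrite -[in leLHS](mulr_powRB1 (ltW (t_gt0 N i)) s0) le_eqVlt.
    by apply/orP; left; apply/eqP; field; rewrite gt_eqF.
  rewrite -ge0_integral_sum//; last 2 first.
  - move=> i; have [mt tr0] := measnneg_trunc (t N i) mv.
    by apply: measurable_funeM; apply/measurable_EFinP; exact: measurable_funM.
  - move=> i x _; have [mt tr0] := measnneg_trunc (t N i) mv.
    by rewrite -EFinM lee_fin !mulr_ge0 ?powR_ge0 ?exprn_ge0.
  rewrite -ge0_integralZl//; last 3 first.
  - apply/measurable_EFinP; apply: (measurableT_comp (measurable_powR s)) => //.
  - by move=> x _; rewrite lee_fin powR_ge0.
  - by rewrite lee_fin ltW.
  apply: ge0_le_integralW => x.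
    apply: sume_ge0 => i _; have [mt tr0] := measnneg_trunc (t N i) mv.
    by rewrite -EFinM lee_fin !mulr_ge0 ?powR_ge0 ?exprn_ge0.
  under eq_bigr do rewrite -EFinM.
  rewrite sumEFin -EFinM lee_fin -mulr_sumr -[leRHS](mulrA (4 `^ s * 3 ^+ n) c).
  rewrite ler_pM2l; last by rewrite mulr_gt0 ?exprn_gt0 ?powR_gt0.
  rewrite -(mulr_powRB1 (v0 x) s0) [leRHS]mulrCA.
  apply: le_trans (ler_wpM2l (v0 x) (dyadic_sum N (K N).+1 (v0 x))).
  rewrite mulr_sumr; apply: ler_sum => i _; rewrite mulrCA ler_wpM2l//.
  rewrite ler_wpM2l ?powR_ge0// indicE.
  have [h|h] := ltP (t N i) (v x); first by rewrite mem_set.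
  by rewrite memNset//= ltNge h.
apply: (@le_trans _ _ (\int[mu]_x limn (f^~ x)))%E.
  apply: ge0_le_integralW => x; first exact: poweR_ge0.
  have fsup N : (f N x <= limn (f^~ x))%E.
    rewrite (cvg_lim _ (ereal_nondecreasing_cvgn (ndf x)))//.
    by apply: ereal_sup_ubound; exists N.
  have big N : N%:R <= 2 ^+ N :> R by rewrite -natrX ler_nat ltnW// ltn_expl.
  have M0 := maxfun_ge0 x mv; case M : (maxfun v x) => [r||].
  - move: M0; rewrite M lee_fin le_eqVlt => /predU1P[<-|r0].
      by rewrite poweR0r ?gt_eqF//; exact: le_trans (f0 0%N x) (fsup 0%N).
    (* For this [N], [r] lies below the upper cutoff and above the lower one, so [f N x] already
       equals the full power. *)
    pose N := maxn (Num.bound r) (Num.bound (2 / r)); apply: le_trans (fsup N).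
    have rN : r < 2 ^+ N.
      apply: (lt_le_trans (archi_boundP (ltW r0))).
      by apply: le_trans (big _); rewrite ler_nat leq_maxl.
    have rN' : 2 / r < 2 ^+ N.
      apply: (lt_le_trans (archi_boundP _)); first by rewrite divr_ge0// ltW.
      by apply: le_trans (big _); rewrite ler_nat leq_maxr.
    rewrite /f M ifT; last first.
      rewrite lte_fin /t expr0 mul1r ltr_pdivrMr ?exprn_gt0// mulrC.
      by rewrite -ltr_pdivrMr.
    rewrite min_l// tKE lee_fin (le_trans (ltW rN))// mulrA ler_peMl ?exprn_ge0//.
    by rewrite -natrM ler1n.
  - rewrite poweRyr ?gt_eqF// leye_eq; apply/eqP/eqyP => A A0.
    apply: le_trans (fsup (Num.bound A)); rewrite /f M ltry.
    rewrite min_r ?leey// poweR_EFin lee_fin tKE.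
    set B : R := 2 * _; have B1 : 1 <= B.
      rewrite /B mulrA -natrM mulr_ege1// ?exprn_ege1 ?ler1n//.
    apply: le_trans (le1r_powR B1 (ltW s1)).
    apply: (le_trans (ltW (archi_boundP (ltW A0)))); apply: (le_trans (big _)).
    by rewrite /B mulrA ler_peMl ?exprn_ge0// -natrM ler1n.
  - by move: M0; rewrite M.
rewrite monotone_convergence//.
apply: lime_le; last exact: nearW.
apply: ereal_nondecreasing_is_cvgn => i j ij.
apply: ge0_le_integralW => // x; exact: ndf.
Qed.
End MaximalStrong.

(** * Smooth functions of one variable *)

Section Smooth.
Variable R : realType.
Implicit Types (f g : R -> R).

(** Successive derivatives are exhibited rather than computed by iterating [derive1], so closure
    under sums, products and inverses is a single induction on [k]. *)
Fixpoint Ck k f : Prop := if k is k'.+1 then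
  exists2 g, (forall x, is_derive x (1 : R) f (g x)) & Ck k' g else True.

Definition smooth f := forall k, Ck k f.

Lemma CkS k f : Ck k.+1 f -> Ck k f.
Proof.
elim: k f => // k IH f [g fg gk]; exists g => //; exact: IH.
Qed.

Lemma Ck_cst k (c : R) : Ck k (fun=> c).
Proof.
elim: k c => // k IH c; exists (fun=> 0); last exact: IH.
by move=> x; exact: is_derive_cst.
Qed.

Lemma CkD k f g : Ck k f -> Ck k g -> Ck k (fun x => f x + g x).
Proof.
elim: k f g => // k IH f g [f' ff' f'k] [g' gg' g'k].
exists (fun x => f' x + g' x); last exact: IH.
by move=> x; apply: is_deriveD.
Qed.

Lemma CkM k f g : Ck k f -> Ck k g -> Ck k (fun x => f x * g x).
Proof.
elim: k f g => // k IH f g /[dup] fk [f' ff' f'k] /[dup] gk [g' gg' g'k].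
exists (fun x => f x * g' x + g x * f' x).
  by move=> x; apply: is_deriveM.
by apply: CkD; apply: IH => //; exact: CkS.
Qed.

Lemma CkV k f : (forall x, f x != 0) -> Ck k f -> Ck k (fun x => (f x)^-1).
Proof.
move=> f0; elim: k => // k IH /[dup] fk [f' ff' f'k].
exists (fun x => (-1) * f' x * (f x)^-1 * (f x)^-1).
  move=> x; apply: (is_derive_eq (is_deriveV (f0 x) (ff' x))).
  rewrite /GRing.scale/=; field; exact: f0.
have fV : Ck k (fun x => (f x)^-1) by apply: IH; exact: CkS.
by do 2 (apply: CkM => //); apply: CkM => //; exact: Ck_cst.
Qed.

Lemma is_derive_affine f f' (a b : R) : (forall x, is_derive x (1 : R) f (f' x)) ->
  forall x, is_derive x (1 : R) (fun x => f (a * x + b)) (a * f' (a * x + b)).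
Proof.
move=> ff' x; rewrite mulrC.
apply: (@is_derive1_comp _ f (fun x => a * x + b) x) => //.
rewrite -[X in is_derive _ _ _ X]addr0; apply: is_deriveD.
by apply: (is_derive_eq (is_deriveZ a (is_derive_id x 1))); rewrite /GRing.scale/= mulr1.
Qed.

Lemma Ck_affine k f (a b : R) : Ck k f -> Ck k (fun x => f (a * x + b)).
Proof.
elim: k f => // k IH f [f' ff' f'k]; exists (fun x => a * f' (a * x + b)).
  exact: is_derive_affine.
by apply: CkM; [exact: Ck_cst|exact: IH].
Qed.

Lemma Ck_id k : Ck k (fun x => x).
Proof.
case: k => // k; exists (fun=> 1); last exact: Ck_cst.
by move=> x; exact: is_derive_id.
Qed.

(** Each order [k] comes with its own witness for the derivative; uniqueness of derivatives
    identifies them all. *)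
Lemma smooth_derive f : smooth f ->
  (forall x, is_derive x (1 : R) f (f^`()%classic x)) /\ smooth (f^`())%classic.
Proof.
move=> sf; have [g fg _] := sf 1%N.
have -> : f^`()%classic = g by apply/funext => x; rewrite derive1E; exact: derive_val.
split=> // k; have [h fh hk] := sf k.+1.
by rewrite (_ : g = h)//; apply/funext => x; rewrite -(@derive_val _ _ _ _ _ _ _ (fg x))
  (@derive_val _ _ _ _ _ _ _ (fh x)).
Qed.

Lemma smooth_derive1n f k : smooth f -> smooth (f^`(k))%classic.
Proof. by move=> sf; elim: k => [//|k IH]; rewrite derive1nS; apply smooth_derive. Qed.

Lemma smooth_continuous f : smooth f -> continuous f.
Proof.
move=> /smooth_derive[df _] x; apply: differentiable_continuous.
apply/derivable1_diffP; apply: ex_derive.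
Qed.

(** * A smooth step and a bump of unit mass from [exp(-1/t)] *)

Definition flat (P : {poly R}) : R -> R :=
  fun t => if 0 < t then P.[t^-1] * expR (- t^-1) else 0.

(** From [s^(i+1) / (i+1)! <= exp s] at [s = 1/t], each monomial satisfies
    [t^(-i) * exp(-1/t) <= (i+1)! * t]. *)
Lemma flat_le P : exists2 C, 0 <= C & forall t, `|flat P t| <= C * `|t|.
Proof.
exists (\sum_(i < size P) `|P`_i| * (i.+1)`!%:R).
  by apply: sumr_ge0 => i _; rewrite mulr_ge0.
move=> t; rewrite /flat; case: ifPn => [t0|_]; last first.
  by rewrite normr0 mulr_ge0//; apply: sumr_ge0 => i _; rewrite mulr_ge0.
rewrite horner_coef mulr_suml mulr_suml; apply: (le_trans (ler_norm_sum _ _ _)).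
apply: ler_sum => i _; rewrite !normrM -!mulrA ler_wpM2l//.
rewrite !gtr0_norm ?exprn_gt0 ?invr_gt0 ?expR_gt0//.
rewrite expRN ler_pdivrMr ?expR_gt0//.
have := @expR_ge1Dxn R t^-1 i; rewrite invr_ge0 (ltW t0) => /(_ isT) h.
have {h} : t^-1 ^+ i.+1 / i.+1`!%:R <= expR t^-1 by apply: le_trans h; rewrite lerDr.
rewrite ler_pdivrMr ?ltr0n ?fact_gt0// => h.
rewrite -(ler_pM2l (x := t^-1)) ?invr_gt0// -exprS (le_trans h)//.
by rewrite le_eqVlt; apply/orP; left; apply/eqP; field; rewrite gt_eqF.
Qed.

(** The family [flat P] is closed under differentiation, with [P] replaced by [X^2 (P - P')];
    smoothness follows by induction on the order. *)
Lemma is_derive_flat P t :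
  is_derive t (1 : R) (flat P) (flat ('X^2 * (P - P^`())) t).
Proof.
have [t0|t0|<-] := ltgtP 0 t.
- suff d : is_derive t (1 : R) (fun t => P.[t^-1] * expR (- t^-1))
      (flat ('X^2 * (P - P^`())) t).
    apply: near_eq_is_derive d.
    near=> u; rewrite /flat ifT//; near: u; exact: lt_nbhsr.
  rewrite /flat t0.
  have dV : is_derive t (1 : R) (fun u : R => u^-1) (- t ^- 2).
    apply: (is_derive_eq (is_deriveV (f := id) (x := t) _ (is_derive_id t 1))).
      by rewrite gt_eqF.
    by rewrite /GRing.scale/= mulr1.
  have d1 := is_derive1_comp (is_derive_poly P t^-1) dV.
  have dN : is_derive t (1 : R) (fun u : R => - u^-1) (t ^- 2).
    by apply: (is_derive_eq (is_deriveN dV)); rewrite opprK.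
  have d2 := @is_derive1_comp _ expR (fun u => - u^-1) t _ _ (is_derive_expR _) dN.
  apply: (is_derive_eq (is_deriveM d1 d2)).
  change (P.[t^-1] * (expR (- t^-1) * t ^- 2) +
    expR (- t^-1) * (P^`().[t^-1] * - t ^- 2) =
    ('X^2 * (P - P^`())).[t^-1] * expR (- t^-1)).
  rewrite hornerM hornerXn hornerD hornerN; field.
  by rewrite gt_eqF.
- rewrite [X in is_derive _ _ _ X]/flat ltNge ltW//=.
  apply: near_eq_is_derive (is_derive_cst (0 : R) t 1).
  near=> u; rewrite /flat ifF//; apply/negbTE; rewrite -leNgt ltW//; near: u.
  exact: lt_nbhsl.
- rewrite [X in is_derive _ _ _ X]/flat ltxx.
  have [C C0 CP] := flat_le ('X * P).
  (* The difference quotient at 0 belongs to the same family, with polynomial ['X * P], so [flat_le]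
     forces it to 0. *)
  have qE : (fun h : R => h^-1 *: ((flat P \o shift 0) (h *: 1) - flat P 0)) =1
            flat ('X * P).
    move=> h; rewrite /= /GRing.scale/= mulr1 addr0 /flat ltxx subr0.
    case: ifPn => _; last by rewrite mulr0.
    by rewrite !hornerE.
  have cv : (fun h : R => h^-1 *: ((flat P \o shift 0) (h *: 1) - flat P 0)) @ 0^' --> 0.
    have C1 : 0 < C + 1 by rewrite ltr_wpDl.
    apply/cvgr0Pnorm_le => e e0; near=> h; rewrite qE (le_trans (CP h))//.
    apply: (@le_trans _ _ ((C + 1) * `|h|)); first by rewrite ler_wpM2r// lerDl.
    rewrite mulrC -ler_pdivlMr// ltW//; near: h; apply: dnbhs0_lt.
    exact: divr_gt0.
  by apply: DeriveDef; [apply/cvg_ex; exists 0|exact: cvg_lim cv].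
Unshelve. all: by end_near. Qed.

Lemma smooth_flat P : smooth (flat P).
Proof.
move=> k; elim: k P => // k IH P.
by exists (flat ('X^2 * (P - P^`()))) => // x; exact: is_derive_flat.
Qed.

Let beta := flat 1.
Let beta' := flat ('X^2 * (1 - 1^`())).

Let beta_gt0 t : 0 < t -> 0 < beta t.
Proof. by move=> t0; rewrite /beta /flat t0 hornerC mul1r expR_gt0. Qed.

Let beta_ge0 t : 0 <= beta t.
Proof. by rewrite /beta /flat; case: ifP => // _; rewrite hornerC mul1r expR_ge0. Qed.

Let beta'_ge0 t : 0 <= beta' t.
Proof.
rewrite /beta' /flat; case: ifP => // t0.
rewrite hornerM hornerXn hornerD hornerN derivC horner0 hornerC subr0 mulr1.
by rewrite mulr_ge0 ?expR_ge0 ?exprn_ge0 ?invr_ge0 ?ltW.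
Qed.

Let flat0 P t : t <= 0 -> flat P t = 0.
Proof. by move=> t0; rewrite /flat ltNge t0. Qed.

(** The usual transition from 0 at -1 to 1 at 1. The arguments are written as [1 * t + 1] and
    [-1 * t + 1] to match the shape of [Ck_affine]. *)
Definition step : R -> R := fun t => beta (1 * t + 1) / (beta (1 * t + 1) + beta (-1 * t + 1)).

Let den t : R := beta (1 * t + 1) + beta (-1 * t + 1).

Let den_gt0 t : 0 < den t.
Proof.
rewrite /den; have [t0|t0] := ltP 0 t.
  by rewrite ltr_pwDl ?beta_gt0// mul1r addr_gt0.
by rewrite ltr_pwDr// beta_gt0// mulN1r ltr_pwDr// oppr_ge0.
Qed.

Lemma smooth_step : smooth step.
Proof.
move=> k; apply: CkM; first by apply: Ck_affine; exact: smooth_flat.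
apply: CkV; first by move=> x; rewrite gt_eqF// den_gt0.
by apply: CkD; apply: Ck_affine; exact: smooth_flat.
Qed.

Lemma step0 t : t <= -1 -> step t = 0.
Proof.
move=> t1; rewrite /step (_ : beta (1 * t + 1) = 0) ?mul0r//.
by apply: flat0; rewrite mul1r -lerBrDr sub0r.
Qed.

Lemma step1 t : 1 <= t -> step t = 1.
Proof.
move=> t1; have b0 : beta (-1 * t + 1) = 0.
  by apply: flat0; rewrite mulN1r addrC subr_le0.
have := den_gt0 t; rewrite /den /step b0 addr0 => h.
by rewrite divff// gt_eqF.
Qed.

Lemma step_ge0 t : 0 <= step t.
Proof. by rewrite divr_ge0// ltW// den_gt0. Qed.

Lemma step_le1 t : step t <= 1.
Proof. by rewrite ler_pdivrMr ?den_gt0// [leRHS]mul1r lerDl. Qed.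

(** A bump defined as a derivative has an explicit primitive: its mass is 1 because [step] climbs
    from 0 to 1, and the difference of two rescaled bumps is the derivative of a compactly supported
    function. *)
Definition psi : R -> R := step^`()%classic.

(** The quotient rule, grouped into products of nonnegative factors: sign and support can both be
    read off. *)
Let psiE t : psi t = (beta' (1 * t + 1) * beta (-1 * t + 1) +
  beta (1 * t + 1) * beta' (-1 * t + 1)) / den t ^+ 2.
Proof.
rewrite /psi derive1E; apply: derive_val.
have d1 := is_derive_affine 1 1 (is_derive_flat 1) t.
have d2 := is_derive_affine (-1) 1 (is_derive_flat 1) t.
have d0 : den t != 0 by rewrite gt_eqF.
have dd := is_deriveV d0 (is_deriveD d1 d2).
apply: (is_derive_eq (is_deriveM d1 dd)).
rewrite -/beta -/beta'; change (beta (1 * t + 1) * (- den t ^- 2 *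
   (1 * beta' (1 * t + 1) + -1 * beta' (-1 * t + 1))) +
  (den t)^-1 * (1 * beta' (1 * t + 1)) = (beta' (1 * t + 1) * beta (-1 * t + 1) +
  beta (1 * t + 1) * beta' (-1 * t + 1)) / den t ^+ 2).
have := d0; rewrite /den => d0'; field; exact: d0'.
Qed.

Lemma smooth_psi : smooth psi.
Proof. by apply smooth_derive; exact: smooth_step. Qed.

Lemma psi_ge0 t : 0 <= psi t.
Proof. by rewrite psiE divr_ge0 ?exprn_ge0 ?addr_ge0 ?mulr_ge0// ltW. Qed.

Lemma psi0 t : 1 <= `|t| -> psi t = 0.
Proof.
rewrite ler_normr => /orP[] t1; rewrite psiE /beta /beta'.
  have h : -1 * t + 1 <= 0 by lra.
  by rewrite !(flat0 _ h) !mulr0 addr0 mul0r.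
have h : 1 * t + 1 <= 0 by lra.
by rewrite !(flat0 _ h) !mul0r addr0 mul0r.
Qed.

Lemma psi_bounded : exists2 B, 0 < B & forall t, psi t <= B.
Proof.
have cpsi : {within `[-1, 1], continuous psi}.
  by apply: continuous_subspaceT; exact: smooth_continuous smooth_psi.
have [|c _ cP] := EVT_max _ cpsi; first lra.
exists (psi c + 1); first by rewrite ltr_wpDl ?psi_ge0.
move=> t; have [t1|t1] := leP `|t| 1; last by rewrite psi0 ?addr_ge0 ?psi_ge0// ltW.
by rewrite (le_trans (cP _ _)) ?lerDl// in_itv/= -ler_norml.
Qed.

Definition step_at (a r : R) : R -> R := fun t => step (r^-1 * t + - (a / r)).
Definition psi_at (a r : R) : R -> R := fun t => r^-1 * psi (r^-1 * t + - (a / r)).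

Let scE (a r t : R) : r^-1 * t + - (a / r) = (t - a) / r.
Proof. by rewrite mulrBl mulrC. Qed.

Lemma is_derive_step_at a r t : is_derive t (1 : R) (step_at a r) (psi_at a r t).
Proof. by apply: is_derive_affine; apply smooth_derive; exact: smooth_step. Qed.

Lemma derive1_step_at a r : (step_at a r)^`()%classic = psi_at a r.
Proof.
apply/funext => t; rewrite derive1E; apply: derive_val.
exact: is_derive_step_at.
Qed.

Lemma smooth_step_at a r : smooth (step_at a r).
Proof. by move=> k; apply: Ck_affine; exact: smooth_step. Qed.

Lemma smooth_psi_at a r : smooth (psi_at a r).
Proof.
by move=> k; apply: CkM; [exact: Ck_cst|apply: Ck_affine; exact: smooth_psi].
Qed.

Lemma psi_at_ge0 a r t : 0 < r -> 0 <= psi_at a r t.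
Proof. by move=> r0; rewrite mulr_ge0 ?psi_ge0// invr_ge0 ltW. Qed.

Lemma psi_at0 a r t : 0 < r -> r <= `|t - a| -> psi_at a r t = 0.
Proof.
move=> r0 ta; rewrite /psi_at psi0 ?mulr0// scE normrM normfV (gtr0_norm r0).
by rewrite ler_pdivlMr// mul1r.
Qed.

Lemma step_at0 a r t : 0 < r -> t <= a - r -> step_at a r t = 0.
Proof. by move=> r0 ta; rewrite /step_at step0// scE ler_pdivrMr// mulN1r; lra. Qed.

Lemma step_at1 a r t : 0 < r -> a + r <= t -> step_at a r t = 1.
Proof. by move=> r0 ta; rewrite /step_at step1// scE ler_pdivlMr// mul1r; lra. Qed.

Lemma integral_psi_at a r : 0 < r ->
  (\int[@lebesgue_measure R]_t (psi_at a r t)%:E = 1)%E.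
Proof.
move=> r0; pose D : set R := `[a - r, a + r]%classic.
have sE : (fun t => (psi_at a r t)%:E) = (fun t => (psi_at a r t)%:E) \_ D.
  apply/funext => t; rewrite /patch; case: ifPn => // /negP tD.
  rewrite psi_at0//; case: leP => // h; exfalso; apply: tD.
  by rewrite inE /D/= in_itv/= -ler_distl ltW.
rewrite sE -integral_mkcond.
have cst_ : continuous (step_at a r) by exact: smooth_continuous (smooth_step_at a r).
rewrite (@continuous_FTC2 _ _ (step_at a r)).
- by rewrite step_at1// step_at0// sube0.
- lra.
- by apply: continuous_subspaceT; exact: smooth_continuous (smooth_psi_at a r).
- split; first by move=> x _; have [] := is_derive_step_at a r x.
  + by apply: cvg_at_right_filter; exact: cst_.
  + by apply: cvg_at_left_filter; exact: cst_.
- by move=> x _; rewrite derive1_step_at.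
Qed.

End Smooth.

(** * Tensor test functions *)

Section Tensor.
Variables (R : realType) (n : nat).
Implicit Types (f g : 'I_n -> R -> R) (u : 'rV[R]_n).

Definition tens f u : R := \prod_j f j (u ord0 j).

Definition upd f i (h : R -> R) : 'I_n -> R -> R := fun j => if j == i then h else f j.

Lemma tens_upd f i h u :
  tens (upd f i h) u = h (u ord0 i) * \prod_(j | j != i) f j (u ord0 j).
Proof.
rewrite /tens (bigD1 i)//= /upd eqxx; congr (_ * _).
by apply: eq_bigr => j /negbTE ->.
Qed.

Lemma tensD1 f i u :
  tens f u = f i (u ord0 i) * \prod_(j | j != i) f j (u ord0 j).
Proof. by rewrite /tens (bigD1 i). Qed.

Lemma is_derive_tens f i (f' : R -> R) u :
  (forall x, is_derive x (1 : R) (f i) (f' x)) ->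
  is_derive u (evec R i) (tens f) (tens (upd f i f') u).
Proof.
move=> ff'; set c := \prod_(j | j != i) f j (u ord0 j).
have [dd dE] := ff' (u ord0 i).
have qE : (fun h : R => h^-1 *: ((tens f \o shift u) (h *: evec R i) - tens f u)) =
   (fun h : R => c * (h^-1 *: ((f i \o shift (u ord0 i)) (h *: (1 : R)) - f i (u ord0 i)))).
  apply/funext => h /=; rewrite (tensD1 f i (_ + _)) (tensD1 f i u) -/c.
  rewrite !mxE eqxx (eq_bigr (fun j => f j (u ord0 j))) -/c; last first.
    by move=> j ji; rewrite !mxE eq_sym (negbTE ji) mulr0 add0r.
  rewrite /GRing.scale/=; ring.
have cv : (fun h : R => h^-1 *: ((tens f \o shift u) (h *: evec R i) - tens f u))
    @ 0^' --> tens (upd f i f') u.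
  rewrite qE tens_upd -/c mulrC -dE.
  by apply: cvgM; [exact: cvg_cst|exact: dd].
by apply: DeriveDef; [apply/cvg_ex; eexists; exact: cv|exact: cvg_lim cv].
Qed.

Lemma smooth_is_derive (h : R -> R) x : smooth h ->
  is_derive x (1 : R) h (h^`()%classic x).
Proof. by move=> /smooth_derive[]. Qed.

Lemma dpart_tens s f : (forall j, smooth (f j)) ->
  dpart s (tens f) = tens (fun j => ((f j)^`(count_mem j s))%classic).
Proof.
move=> sf; elim: s => [|i s IH]; first by [].
rewrite [LHS]/= -/(dpart s (tens f)) IH; apply/funext => u.
rewrite (@derive_val _ _ _ _ _ _ _ (@is_derive_tens _ i _ u
  (fun x => smooth_is_derive x (smooth_derive1n (count_mem i s) (sf i))))).
apply: eq_bigr => j _; rewrite /upd /= eq_sym; by case: eqVneq => [->|_].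
Qed.

Lemma continuous_tens f : (forall j, continuous (f j)) -> continuous (tens f).
Proof.
move=> cf; rewrite /tens; elim: (index_enum _) => [|j r IH] u.
  have -> : (fun u => \prod_(j <- [::]) f j (u ord0 j)) = cst 1.
    by apply/funext => v; rewrite big_nil.
  exact: cst_continuous.
have -> : (fun u => \prod_(j <- j :: r) f j (u ord0 j)) =
    (fun v : 'rV[R]_n => f j (v ord0 j)) \*
    (fun v : 'rV[R]_n => \prod_(j <- r) f j (v ord0 j)).
  by apply/funext => v; rewrite big_cons.
apply: continuousM; last exact: IH.
apply: (continuous_comp (f := fun u : 'rV[R]_n => u ord0 j)); first exact: coord_continuous.
exact: cf.
Qed.

Definition test1 (h : R -> R) := smooth h /\ exists A, forall t, A < `|t| -> h t = 0.

Lemma test1_derive h : test1 h -> test1 (h^`()%classic).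
Proof.
move=> [sh [A hA]]; split; first by apply smooth_derive.
exists A => t At; rewrite derive1E (@near_eq_derive _ _ _ h (cst 0)) ?derive_cst//.
near=> x; apply: hA; near: x.
apply: (cvgr_gt `|t|) => //; exact: norm_continuous.
Unshelve. all: by end_near. Qed.

Lemma test1M h k : test1 h -> smooth k -> test1 (fun t => h t * k t).
Proof.
move=> [sh [A hA]] sk; split; first by move=> j; exact: CkM.
by exists A => t /hA ->; rewrite mul0r.
Qed.

Lemma test_fun_tens f : (forall j, test1 (f j)) -> test_fun (tens f).
Proof.
move=> tf; have sf j : smooth (f j) by case: (tf j).
split=> [s|].
  rewrite dpart_tens//; split.
    by apply: continuous_tens => j; apply: smooth_continuous; exact: smooth_derive1n.
  move=> i u; have [] := @is_derive_tens
    (fun j => ((f j)^`(count_mem j s))%classic) i _ u (fun x => smooth_is_derive x (smooth_derive1n (count_mem i s) (sf i))); by [].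
have /choice[A hA] j : exists A, forall t, A < `|t| -> f j t = 0 by case: (tf j).
exists [set v | forall i, `[- A i, A i]%classic (v ord0 i)]; split.
  apply: (@rV_compact R n (fun i => `[- A i, A i]%classic)) => i.
  exact: segment_compact.
move=> u /existsNP[i ui]; rewrite (tensD1 f i) hA ?mul0r//.
by rewrite ltNge; apply/negP; rewrite ler_norml => ui'; apply: ui; rewrite /= in_itv.
Qed.

Lemma test1_upd f i h : (forall j, test1 (f j)) -> test1 h -> forall j, test1 (upd f i h j).
Proof. by move=> tf th j; rewrite /upd; case: eqP. Qed.

(** The word [s'] is free up to permutation because [mseq] lists directions in a fixed order, and
    putting [i] in front of such a list usually breaks that order. *)
Lemma dpart_upd s s' i f : (forall j, test1 (f j)) -> perm_eq s' (i :: s) ->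
  dpart s (tens (upd f i (f i)^`()%classic)) = dpart s' (tens f).
Proof.
move=> tf ss'; have sf j : smooth (f j) by case: (tf j).
have sf' : smooth ((f i)^`()%classic) by case: (test1_derive (tf i)).
rewrite !dpart_tens//; last by move=> j; rewrite /upd; case: eqP.
congr tens; apply/funext => j; rewrite (permP ss')/= /upd eq_sym.
by case: eqVneq => [->|_] //=; rewrite /derive1n -iterSr.
Qed.

End Tensor.

(** * Local integrability *)

Section Integrability.
Variables (R : realType) (n : nat).
Local Notation rv := 'rV[R]_n.
Local Notation mu := (mun R n).
Implicit Types (f g : rv -> R) (phi : 'I_n -> R -> R).

Definition rmeas f := measurable_fun setT (f : borelRn R n -> R).

Lemma rmeas_borel f : borel_fun f -> rmeas f.
Proof. by move=> bf _ B mB; rewrite setTI; exact: bf. Qed.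

Lemma rmeas_continuous f : continuous f -> rmeas f.
Proof.
move=> cf; apply: (measurability _ (RGenOpens.measurableE R)) => _ [_ [a [b ->]] <-].
rewrite setTI; apply: measurable_open; apply: open_comp; last exact: interval_open.
by move=> x _; exact: cf.
Qed.

Lemma sintE f : rmeas f -> sint f = (\int[mu]_u (f u)%:E)%E.
Proof.
move=> mf; rewrite /sint integralE !iintE//; last 4 first.
- by apply/measurable_EFinP; apply: measurable_maxr => //; exact: measurableT_comp.
- by move=> x; rewrite lee_fin le_max lexx orbT.
- by apply/measurable_EFinP; apply: measurable_maxr.
- by move=> x; rewrite lee_fin le_max lexx orbT.
congr (_ - _)%E; apply: eq_integral => u _.
  by rewrite funeposE EFin_max.
by rewrite funenegE -EFinN EFin_max.
Qed.

Definition lint f := rmeas f /\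
  forall r, 0 < r -> (\int[mu]_(u in (ball (0%R : rv) r : set (borelRn R n))) `|f u|%:E < +oo)%E.

Lemma integrable_lint f g A B : lint f -> rmeas g -> 0 < A ->
  (forall u, `|g u| <= B) -> (forall u, ~ ball (0 : rv) A u -> g u = 0) ->
  mu.-integrable setT (EFin \o (fun u => f u * g u)).
Proof.
move=> [mf lf] mg A0 gB gA; have mfg : rmeas (fun u => f u * g u) by exact: measurable_funM.
have B0 : 0 <= B by exact: le_trans (gB 0).
apply/integrableP; split; first exact/measurable_EFinP.
have mb := @measurable_rVball R n 0 A.
have mfa (D : set (borelRn R n)) : measurable_fun D (fun u : borelRn R n => `|f u|%:E).
  by apply/measurable_EFinP; apply: measurableT_comp => //; exact: measurable_funS mf.
apply: (@le_lt_trans _ _ (B%:E * \int[mu]_(u in (ball (0%R : rv) A : set (borelRn R n)))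
    `|f u|%:E)%E); last first.
  by rewrite lte_mul_pinfty ?lee_fin ?lf.
rewrite -ge0_integralZl// integral_mkcond.
apply: ge0_le_integralW => // u; rewrite /patch; case: ifPn => [_|/negP uA].
  by rewrite /= -EFinM lee_fin normrM mulrC ler_wpM2r.
by rewrite /= gA ?mulr0 ?normr0// => uA'; apply: uA; rewrite inE.
Qed.

Lemma test1_bounded (h : R -> R) : test1 h -> exists2 B, 0 <= B & forall t, `|h t| <= B.
Proof.
move=> [sh [A hA]]; pose A' := `|A| + 1.
have ch : {within `[- A', A'], continuous (fun t => `|h t|)}.
  apply: continuous_subspaceT => x; apply: continuous_comp; last exact: norm_continuous.
  exact: smooth_continuous.
have [|c _ cP] := EVT_max _ ch; first by rewrite /A'; have := normr_ge0 A; lra.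
exists `|h c| => // t; have [tA|tA] := leP `|t| A'.
  by apply: cP; rewrite in_itv/= -ler_norml.
rewrite hA ?normr0//; apply: le_lt_trans tA.
by rewrite /A'; have := ler_norm A; lra.
Qed.

Lemma tens_bounded phi : (forall j, test1 (phi j)) ->
  exists2 B, 0 <= B & forall u, `|tens phi u| <= B.
Proof.
move=> tp; have /choice[B BP] j : exists B, 0 <= B /\ forall t, `|phi j t| <= B.
  by have [B B0 BP] := test1_bounded (tp j); exists B.
exists (\prod_j B j); first by apply: prodr_ge0 => j _; case: (BP j).
move=> u; rewrite /tens normr_prod; apply: ler_prod => j _.
by rewrite normr_ge0/=; case: (BP j).
Qed.

Lemma tens_support phi : (forall j, test1 (phi j)) ->
  exists2 A, 0 < A & forall u, ~ ball (0 : rv) A u -> tens phi u = 0.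
Proof.
move=> tp; have /choice[A AP] j : exists A, forall t, A < `|t| -> phi j t = 0.
  by case: (tp j).
pose A' := 1 + \sum_j `|A j|; exists A'.
  by rewrite ltr_pwDl// sumr_ge0.
move=> u uA; apply: contrapT => tu; apply: uA; split.
  by rewrite ltr_pwDl// sumr_ge0.
move=> i j; rewrite ord1 mxE /ball/= sub0r normrN ltNge; apply/negP => uj; apply: tu.
rewrite (tensD1 phi j) AP ?mul0r//; apply: lt_le_trans uj.
rewrite /A' (bigD1 j)//= addrCA (le_lt_trans (ler_norm _))// ltrDl ltr_pwDl//.
by rewrite sumr_ge0.
Qed.

Lemma rmeas_tens phi : (forall j, test1 (phi j)) -> rmeas (tens phi).
Proof.
move=> tp; apply: rmeas_continuous; apply: continuous_tens => j.
by apply: smooth_continuous; case: (tp j).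
Qed.

Lemma integrable_tens f phi : lint f -> (forall j, test1 (phi j)) ->
  mu.-integrable setT (EFin \o (fun u => f u * tens phi u)).
Proof.
move=> lf tp; have [B _ BP] := tens_bounded tp; have [A A0 AP] := tens_support tp.
by apply: (integrable_lint lf (rmeas_tens tp) A0 BP AP).
Qed.

(** Pointwise [|f| <= 1 + |f|^p], and cubes have finite measure. *)
Lemma lint_Lp p f : 1 <= p -> Lp p f -> lint f.
Proof.
move=> p1 [/rmeas_borel mf pf]; split=> // r r0.
have mfa (D : set (borelRn R n)) : measurable_fun D (fun u : borelRn R n => (`|f u| `^ p)%:E).
  apply/measurable_EFinP; apply: (measurableT_comp (measurable_powR p)).
  by apply: measurableT_comp => //; exact: measurable_funS mf.
have mb := @measurable_rVball R n 0 r.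
apply: (@le_lt_trans _ _ (\int[mu]_(u in (ball (0%R : rv) r : set (borelRn R n)))
    (cst 1 u + (`|f u| `^ p)%:E))%E).
  apply: ge0_le_integral => //.
  - by apply/measurable_EFinP; apply: measurableT_comp => //; exact: measurable_funS mf.
  - by apply: emeasurable_funD.
  move=> u _; rewrite /= -EFinD lee_fin.
  have [f1|f1] := leP 1 `|f u|; first by rewrite (le_trans (le1r_powR f1 p1))// lerDr.
  by rewrite (le_trans (ltW f1))// lerDl powR_ge0.
rewrite ge0_integralD//.
rewrite integral_cst// mul1e lte_add_pinfty//.
  by apply: (le_lt_trans _ (ltry ((2 * r) ^+ n))); rewrite -(mun_ball (0 : rv) r0).
apply: le_lt_trans pf; rewrite iintE//.
by apply: ge0_subset_integral => // u _; rewrite lee_fin powR_ge0.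
Qed.

Lemma rn_ae_eqP f g : rn_ae_eq f g -> {ae mu, forall u, f u = g u}.
Proof.
move=> [N [mN [N0 fg]]]; exists N; split=> //.
  rewrite -N0 iintE//; first by rewrite integral_indic// setIT.
  exact/measurable_EFinP/measurable_indic.
by move=> u; apply: contra_notP => /fg.
Qed.

Lemma lint_ae f g : rmeas f -> rn_ae_eq f g -> lint g -> lint f.
Proof.
move=> mf /rn_ae_eqP fg [mg lg]; split=> // r r0.
rewrite (@ae_eq_integral _ _ _ mu _ (fun u => `|g u|%:E)) ?lg//.
- exact: measurable_rVball.
- by apply/measurable_EFinP; apply: measurableT_comp => //; exact: measurable_funS mf.
- by apply/measurable_EFinP; apply: measurableT_comp => //; exact: measurable_funS mg.
- case: fg => N [mN N0 sub]; exists N; split=> // u nu; apply: sub => fu.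
  by apply: nu => /= _; rewrite fu.
Qed.

Lemma integral_ae_tens f g phi : rmeas f -> rmeas g -> rn_ae_eq f g ->
  (forall j, test1 (phi j)) ->
  (\int[mu]_u (f u * tens phi u) = \int[mu]_u (g u * tens phi u))%R.
Proof.
move=> mf mg /rn_ae_eqP fg tp; congr fine; apply: ae_eq_integral => //.
- by apply/measurable_EFinP; apply: measurable_funM => //; exact: rmeas_tens.
- by apply/measurable_EFinP; apply: measurable_funM => //; exact: rmeas_tens.
- case: fg => N [mN N0 sub]; exists N; split=> // u nu; apply: sub => fu.
  by apply: nu => /= _; rewrite fu.
Qed.

End Integrability.

(** * Weak gradient of the Taylor polynomial in its base point *)

Section MultiIndex.
Variables (n : nat).
Implicit Types (a : 'I_n -> nat) (i : 'I_n).

(** A copy of [mseq] for unbounded exponents: raising an entry of a [mindex n m] could leave its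
    range. *)
Definition ms a : seq 'I_n := flatten [seq nseq (a i) i | i <- enum 'I_n].
Definition incr a i : 'I_n -> nat := fun j => (a j + (j == i))%N.
Definition decr a i : 'I_n -> nat := fun j => (a j - (j == i))%N.

Lemma count_ms a j : count_mem j (ms a) = a j.
Proof.
rewrite /ms count_flatten -map_comp sumnE big_map big_enum/=.
rewrite (bigD1 j)//= count_nseq/= eqxx mul1n big1 ?addn0// => i ij.
by rewrite count_nseq/= (negbTE ij).
Qed.

Lemma size_ms a : size (ms a) = (\sum_i a i)%N.
Proof.
rewrite /ms size_flatten /shape -map_comp sumnE big_map big_enum/=.
by apply: eq_bigr => i _; rewrite /= size_nseq.
Qed.

Lemma sum_incr a i : (\sum_j incr a i j = (\sum_j a j).+1)%N.
Proof.
rewrite big_split/= -addn1; congr addn.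
by rewrite (bigD1 i)//= eqxx big1// => j /negbTE ->.
Qed.

Lemma perm_ms_incr a i : perm_eq (ms (incr a i)) (i :: ms a).
Proof.
apply/allP => j _; apply/eqP.
by rewrite /= !count_ms /incr addnC eq_sym.
Qed.

(** Subtracting the unit index [e_i] is a bijection from the indices of order at most [m] with
    [a i > 0] onto those of order below [m]. This is the shift on which the telescoping rests. *)
Lemma sum_mindex_decr (V : nmodType) m i (S : ('I_n -> nat) -> V) :
  \sum_(a : mindex n m | (morder a <= m)%N && (0 < a i)%N) S (decr (fun j => a j) i) =
  \sum_(a : mindex n m | (morder a < m)%N) S (fun j => a j).
Proof.
pose h (b : mindex n m) : mindex n m := [ffun j => inord (b j + (j == i))].
pose h' (a : mindex n m) : mindex n m := [ffun j => inord (a j - (j == i))].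
have h'E (a : mindex n m) j : h' a j = (a j - (j == i))%N :> nat.
  by rewrite ffunE inordK// (leq_ltn_trans (leq_subr _ _)).
have hE (b : mindex n m) j : (b i < m)%N -> h b j = (b j + (j == i))%N :> nat.
  move=> bi; rewrite ffunE inordK//; case: eqVneq => [->|_]; first by rewrite addn1.
  by rewrite addn0.
have oh (b : mindex n m) : (b i < m)%N -> morder (h b) = (morder b).+1.
  by move=> bi; rewrite /morder -(sum_incr (fun j => b j) i); apply: eq_bigr => j _; exact: hE.
rewrite (reindex_onto h h') => [|a /andP[_ ai]]; last first.
  have ai' : (h' a i < m)%N by rewrite h'E eqxx subn1 prednK// -ltnS.
  apply/ffunP => j; apply: val_inj; rewrite /= hE// h'E.
  by case: eqVneq => [->|_]; rewrite ?subn0 ?addn0// subnK.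
apply: eq_big => [b|b /andP[/andP[_ _] /eqP hb]]; last first.
  by congr S; apply/funext => j; rewrite -[in RHS]hb h'E.
have leb j : (b j <= morder b)%N by rewrite /morder (bigD1 j)//= leq_addr.
apply/idP/idP => [/andP[/andP[h1 h2] /eqP h3]|bm].
  have bi : (b i < m)%N.
    (* If [b i] were [m], then [inord] would receive [m.+1], fall back to its default 0, and
       contradict [0 < h b i]. *)
    rewrite ltn_neqAle -ltnS ltn_ord andbT; apply/negP => /eqP bm.
    move: h2; rewrite ffunE eqxx bm addn1 /inord /insubd insubN ?ltnn//.
  by rewrite -oh.
have bi : (b i < m)%N by exact: leq_ltn_trans bm.
rewrite oh// bm hE// eqxx addn1/=; apply/eqP/ffunP => j; apply: val_inj.
by rewrite /= h'E hE// addnK.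
Qed.

End MultiIndex.

Section TaylorWeak.
Variables (R : realType) (n m : nat) (p : R) (F : 'rV[R]_n -> R)
  (G g : seq 'I_n -> 'rV[R]_n -> R).
Hypothesis p1 : 1 <= p.
Hypothesis FG : weak_sobolev m.+1 p F G.
Hypothesis gG : forall s, (size s <= m)%N -> continuous (g s) /\ rn_ae_eq (g s) (G s).
Local Notation rv := 'rV[R]_n.
Local Notation mu := (mun R n).
Implicit Types (phi : 'I_n -> R -> R) (s : seq 'I_n) (a : 'I_n -> nat).

Definition pairing (f : rv -> R) phi : R := \int[mu]_u (f u * tens phi u).

Lemma lintG s : (size s <= m.+1)%N -> lint (G s).
Proof. by move=> sm; apply: lint_Lp p1 _; have [] := FG.2 s sm. Qed.

Lemma lintg s : (size s <= m)%N -> lint (g s).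
Proof.
move=> sm; have [cg gs] := gG sm.
by apply: lint_ae (rmeas_continuous cg) gs _; apply: lintG; exact: leqW.
Qed.

Lemma pairing_gG s phi : (size s <= m)%N -> (forall j, test1 (phi j)) ->
  pairing (g s) phi = pairing (G s) phi.
Proof.
move=> sm tp; have [cg gs] := gG sm; apply: integral_ae_tens => //.
  exact: rmeas_continuous.
by case: (lintG (leqW sm)).
Qed.

Lemma pairingD (f : rv -> R) phi1 phi2 phi3 c :
  mu.-integrable setT (EFin \o (fun u => f u * tens phi1 u)) ->
  mu.-integrable setT (EFin \o (fun u => f u * tens phi2 u)) ->
  (forall u, tens phi3 u = tens phi1 u + c * tens phi2 u) ->
  pairing f phi3 = pairing f phi1 + c * pairing f phi2.
Proof.
move=> i1 i2 e; rewrite /pairing -RintegralZl// -RintegralD//; last first.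
  rewrite (_ : _ \o _ = (fun u : borelRn R n => (c%:E * (f u * tens phi2 u)%:E)%E)).
    exact: integrableZl.
  by apply/funext => u; rewrite /= EFinM.
by apply: eq_Rintegral => u _; rewrite e; ring.
Qed.

(** The definition relates each [G s] to [F] alone. Testing [G s] against the derivative of the
    tensor and [G s'] against the tensor itself produces the same integral of [F]; comparing the
    signs leaves one minus. *)
Lemma weak_derivative s s' i phi : (forall j, test1 (phi j)) -> perm_eq s' (i :: s) ->
  (size s' <= m.+1)%N ->
  pairing (G s) (upd phi i (phi i)^`()%classic) = - pairing (G s') phi.
Proof.
move=> tp ss' sm; have sz : size s' = (size s).+1 by rewrite (perm_size ss').
have sm' : (size s <= m.+1)%N by rewrite (leq_trans _ sm)// sz.
have tp' := test1_upd i tp (test1_derive (tp i)).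
have [_ w1] := FG.2 s sm'; have [_ w2] := FG.2 s' sm.
have := w1 _ (test_fun_tens tp'); rewrite (dpart_upd tp ss') (w2 _ (test_fun_tens tp)).
rewrite !sintE; last 2 first.
- by apply: measurable_funM; [case: (lintG sm')|exact: rmeas_tens].
- by apply: measurable_funM; [case: (lintG sm)|exact: rmeas_tens].
move=> /(congr1 fine); rewrite !fineM//; last 2 first.
- by apply: integrable_fin_num => //; exact: (integrable_tens (lintG sm')).
- by apply: integrable_fin_num => //; exact: (integrable_tens (lintG sm)).
rewrite sz exprS mulN1r mulNr -mulrN => /esym/(mulfI _) h.
by apply: h; rewrite signr_eq0.
Qed.

Variable x : rv.

(** The Taylor factor [(x - u)^a / a!] is distributed over the coordinates, so its product with a
    tensor test function is again one. *)
Definition tmul a phi : 'I_n -> R -> R :=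
  fun j t => (phi j t) * ((a j)`!%:R^-1 * (x ord0 j - t) ^+ a j).

Lemma Ck_pow k (c : R) e : Ck k (fun t => (c - t) ^+ e).
Proof.
elim: e => [|e IH]; first exact: Ck_cst.
have -> : (fun t => (c - t) ^+ e.+1) = (fun t => (-1 * t + c) * (c - t) ^+ e).
  by apply/funext => t; rewrite exprS; congr (_ * _); ring.
by apply: CkM => //; apply: (@Ck_affine _ _ id); exact: Ck_id.
Qed.

Lemma test1_tmul a phi : (forall j, test1 (phi j)) -> forall j, test1 (tmul a phi j).
Proof.
move=> tp j; apply: test1M => // k; apply: CkM; first exact: Ck_cst.
exact: Ck_pow.
Qed.

Lemma tens_tmul a phi u : tens (tmul a phi) u =
  (\prod_j (a j)`!)%:R^-1 * (\prod_j (x - u) ord0 j ^+ a j) * tens phi u.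
Proof.
rewrite /tens /tmul big_split/= mulrC big_split/= natr_prod -prodfV.
by congr (_ * _ * _); apply: eq_bigr => j _; rewrite !mxE.
Qed.

Lemma derive_tmul a phi i t : test1 (phi i) ->
  (tmul a phi i)^`()%classic t = (phi i)^`()%classic t * ((a i)`!%:R^-1 * (x ord0 i - t) ^+ a i)
   - (0 < a i)%N%:R * tmul (decr a i) phi i t.
Proof.
move=> [sp _]; rewrite derive1E; apply: derive_val.
have dp := smooth_is_derive t sp.
have dx : is_derive t (1 : R) (fun t => x ord0 i - t) (-1).
  apply: (is_derive_eq (is_deriveB (is_derive_cst (x ord0 i) t 1) (is_derive_id t 1))).
  by rewrite sub0r.
rewrite /tmul /decr eqxx subn1; case: (a i) => [|k].
  have d0 : is_derive t (1 : R) (fun t => 0`!%:R^-1 * (x ord0 i - t) ^+ 0) 0.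
    have -> : (fun t => 0`!%:R^-1 * (x ord0 i - t) ^+ 0) = cst 1.
      by apply/funext => ?; rewrite expr0 fact0 invr1 mulr1.
    exact: is_derive_cst.
  apply: (is_derive_eq (is_deriveM dp d0)).
  by rewrite scaler0 add0r mul0r subr0 [RHS]mulrC.
have dX := is_deriveX k.+1 dx; rewrite exprfctE in dX.
have dk := is_deriveZ ((k.+1)`!%:R^-1) dX.
apply: (is_derive_eq (is_deriveM dp dk)).
change (phi i t * ((k.+1)`!%:R^-1 * (k.+1%:R * (x ord0 i - t) ^+ k * -1)) +
  (k.+1)`!%:R^-1 * (x ord0 i - t) ^+ k.+1 * (phi i)^`()%classic t =
  (phi i)^`()%classic t * ((k.+1)`!%:R^-1 * (x ord0 i - t) ^+ k.+1) -
  1 * (phi i t * (k`!%:R^-1 * (x ord0 i - t) ^+ k))).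
rewrite factS natrM; field.
by rewrite nat1r !pnatr_eq0 -lt0n fact_gt0.
Qed.

(** The product rule, solved for the term in which [phi i] is differentiated: an exact derivative,
    to be moved onto [G], plus a term of lower degree. The factor [(0 < a i)] removes the latter
    when the monomial is constant in coordinate [i]. *)
Lemma tens_tmul_upd a phi i u : (forall j, test1 (phi j)) ->
  tens (tmul a (upd phi i (phi i)^`()%classic)) u =
  tens (upd (tmul a phi) i (tmul a phi i)^`()%classic) u +
  (0 < a i)%N%:R * tens (tmul (decr a i) phi) u.
Proof.
move=> tp; rewrite tens_upd derive_tmul// !(tensD1 _ i u).
set P := \prod_(j | j != i) tmul a _ j _; set P2 := \prod_(j | _) tmul a phi j _.
set P3 := \prod_(j | _) _.
have -> : P = P2.
  by apply: eq_bigr => j ji; rewrite /tmul /upd (negbTE ji).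
have -> : P3 = P2.
  by apply: eq_bigr => j ji; rewrite /tmul /decr (negbTE ji) subn0.
by rewrite {1}/tmul /upd eqxx; ring.
Qed.

Definition hfun u := taylor m.+1 g u x.

Lemma hfunE phi u : hfun u * tens phi u =
  \sum_(a : mindex n m | (morder a <= m)%N)
     g (mseq a) u * tens (tmul (fun j => a j) phi) u.
Proof.
rewrite /hfun /taylor mulr_suml; apply: eq_bigr => a _.
by rewrite tens_tmul /mfact /mpow; ring.
Qed.

Lemma size_mseq k (a : mindex n k) : size (mseq a) = morder a.
Proof. exact: (size_ms (fun j => a j)). Qed.

Lemma integrable_hfun_term phi (a : mindex n m) : (morder a <= m)%N ->
  (forall j, test1 (phi j)) ->
  mu.-integrable setT (EFin \o (fun u => g (mseq a) u * tens (tmul (fun j => a j) phi) u)).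
Proof.
move=> am tp; apply: integrable_tens; first by apply: lintg; rewrite size_mseq.
exact: test1_tmul.
Qed.

Lemma Rintegral_sum (I : Type) (r : seq I) (P : pred I) (f : I -> rv -> R) :
  (forall i, P i -> mu.-integrable setT (EFin \o (f i : borelRn R n -> R))) ->
  mu.-integrable setT (EFin \o (fun u : borelRn R n => \sum_(i <- r | P i) f i u)) /\
  \int[mu]_u (\sum_(i <- r | P i) f i u) = \sum_(i <- r | P i) \int[mu]_u f i u.
Proof.
move=> fi; elim: r => [|i r [IH1 IH2]].
  have -> : (fun u : borelRn R n => \sum_(i <- [::] | P i) f i u) = cst 0.
    by apply/funext => u; rewrite big_nil.
  by rewrite big_nil Rintegral_cst// mul0r; split=> //; exact: integrable0.
rewrite big_cons.
have -> : (fun u : borelRn R n => \sum_(j <- i :: r | P j) f j u) =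
  (fun u => if P i then f i u + \sum_(j <- r | P j) f j u else \sum_(j <- r | P j) f j u).
  by apply/funext => u; rewrite big_cons.
case: ifPn => [Pi|_]; last by split.
rewrite RintegralD ?IH2//; last exact: fi.
split=> //; apply: (integrableD _ (fi _ Pi) IH1) => //.
Qed.

Lemma pairing_hfun phi : (forall j, test1 (phi j)) ->
  mu.-integrable setT (EFin \o (fun u => hfun u * tens phi u)) /\
  pairing hfun phi = \sum_(a : mindex n m | (morder a <= m)%N)
     pairing (G (mseq a)) (tmul (fun j => a j) phi).
Proof.
move=> tp.
have [i1 i2] := @Rintegral_sum _ (index_enum (mindex n m)) (fun a : mindex n m => (morder a <= m)%N)
  (fun (a : mindex n m) u => g (mseq a) u * tens (tmul (fun j => a j) phi) u)
  (fun (a : mindex n m) am => integrable_hfun_term am tp).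
have -> : (fun u => hfun u * tens phi u) = (fun u =>
    \sum_(a : mindex n m | (morder a <= m)%N) g (mseq a) u * tens (tmul (fun j => a j) phi) u).
  by apply/funext => u; exact: hfunE.
split; first exact: i1.
rewrite /pairing; under eq_Rintegral do rewrite hfunE.
rewrite i2; apply: eq_bigr => a am; apply: pairing_gG; first by rewrite size_mseq.
exact: test1_tmul.
Qed.

(** With [V a] the pairing of [G] at [a + e_i] with [tmul a phi], the term of index [a] contributes
    [- V a + V (a - e_i)], the second part only if [a i > 0]. After the shift everything of order
    below [m] cancels. *)
Lemma weak_derivative_hfun i phi : (forall j, test1 (phi j)) ->
  pairing hfun (upd phi i (phi i)^`()%classic) =
  - \sum_(a : mindex n m | morder a == m)
      pairing (G (ms (incr (fun j => a j) i))) (tmul (fun j => a j) phi).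
Proof.
move=> tp; have tp' := test1_upd i tp (test1_derive (tp i)).
rewrite (pairing_hfun tp').2.
pose V a := pairing (G (ms (incr a i))) (tmul a phi).
have step (a : mindex n m) : (morder a <= m)%N ->
    pairing (G (mseq a)) (tmul (fun j => a j) (upd phi i (phi i)^`()%classic)) =
    - V (fun j => a j) + (0 < a i)%N%:R * V (decr (fun j => a j) i).
  move=> am; have ta := @test1_tmul (fun j => a j) phi tp.
  have sa : (size (mseq a) <= m.+1)%N by rewrite size_mseq leqW.
  rewrite (@pairingD _ (upd (tmul (fun j => a j) phi) i (tmul (fun j => a j) phi i)^`()%classic)
    (tmul (decr (fun j => a j) i) phi) _ (0 < a i)%N%:R).
  - congr (_ + _).
      apply: weak_derivative => //; first exact: perm_ms_incr.
      by rewrite size_ms sum_incr ltnS.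
    case: ltnP => [a0|]; last by rewrite !mul0r.
    congr (_ * pairing (G _) _); congr ms; apply/funext => j.
    by rewrite /incr /decr; case: eqVneq => [->|_]; rewrite ?addn0 ?subn0// subnK.
  - apply: integrable_tens; first exact: lintG.
    by apply: test1_upd => //; exact: test1_derive.
  - by apply: integrable_tens; [exact: lintG|exact: test1_tmul].
  - by move=> u; exact: tens_tmul_upd.
rewrite (eq_bigr _ step) big_split/= sumrN.
rewrite (eq_bigr (fun a : mindex n m => if (0 < a i)%N then V (decr (fun j => a j) i) else 0));
  last by move=> a _; case: ifP; rewrite ?mul1r ?mul0r.
rewrite -big_mkcondr/= sum_mindex_decr.
rewrite (bigID (fun a : mindex n m => morder a == m))/=.
rewrite [X in - (_ + X)](eq_bigl (fun a : mindex n m => (morder a < m)%N)); last first.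
  by move=> a; rewrite ltn_neqAle andbC.
rewrite opprD addrNK; congr (- _); apply: eq_bigl => a.
by case: eqVneq => [->|]; rewrite ?leqnn ?andbF.
Qed.

End TaylorWeak.

(** * Averages against tensor bumps *)

Lemma integral_tens (R : realType) n (f : 'I_n -> R -> R) :
  (forall j, measurable_fun setT (f j)) -> (forall j t, 0 <= f j t) ->
  (forall j, \int[@lebesgue_measure R]_t (f j t)%:E = 1)%E ->
  (\int[mun R n]_u (tens f u)%:E = 1)%E.
Proof.
have mt k (h : 'I_k -> R -> R) : (forall j, measurable_fun setT (h j)) ->
    measurable_fun setT (fun u : borelRn R k => (tens h u)%:E).
  move=> mh; apply/measurable_EFinP; rewrite /tens.
  apply: measurable_prod => j _; apply: measurableT_comp => //.
  exact: measurable_fun_coord.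
elim: n f => [|n IH] f mf f0 f1.
  rewrite /= integral_dirac//; last exact: mt.
  by rewrite /tens big_ord0 mule1 diracT.
rewrite integral_munS; [|exact: mt|by move=> u; rewrite lee_fin prodr_ge0].
rewrite -[RHS](f1 ord0); apply: eq_integral => t _.
rewrite (eq_integral (fun y : borelRn R n =>
    ((f ord0 t)%:E * (tens (fun j => f (lift ord0 j)) y)%:E)%E)); last first.
  move=> y _; rewrite -EFinM /tens big_ord_recl consv0; congr (_ * _)%:E.
  by apply: eq_bigr => j _; rewrite consvS.
rewrite ge0_integralZl//; [|exact: mt|by move=> y _; rewrite lee_fin prodr_ge0|by rewrite lee_fin].
by rewrite IH ?mule1.
Qed.

Section Averages.
Variables (R : realType) (n m : nat) (p : R) (F : 'rV[R]_n -> R)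
  (G g : seq 'I_n -> 'rV[R]_n -> R).
Hypothesis p1 : 1 <= p.
Hypothesis FG : weak_sobolev m.+1 p F G.
Hypothesis gG : forall s, (size s <= m)%N -> continuous (g s) /\ rn_ae_eq (g s) (G s).
Local Notation rv := 'rV[R]_n.
Local Notation mu := (mun R n).
Implicit Types (phi : 'I_n -> R -> R) (a : 'I_n -> nat).

Lemma pairing_bound (f : rv -> R) phi (c : rv) (rho B : R) : lint f -> (forall j, test1 (phi j)) ->
  (forall u, ~ ball c rho u -> tens phi u = 0) -> (forall u, `|tens phi u| <= B) ->
  (`|pairing f phi|%:E <= B%:E * ballint (fun u => `|f u|%R) c rho)%E.
Proof.
move=> lf tp supp bd; have [mf _] := lf.
rewrite EFin_normr_Rintegral//; last exact: integrable_tens.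
apply: (le_trans (le_abse_integral _ _ _)) => //.
  by apply/measurable_EFinP; apply: measurable_funM => //; exact: rmeas_tens.
rewrite /ballint -ge0_integralZl//; last 3 first.
- exact: measurable_rVball.
- by apply/measurable_EFinP; apply: measurableT_comp => //; exact: measurable_funS mf.
- by rewrite lee_fin (le_trans _ (bd 0)).
rewrite [leRHS]integral_mkcond; apply: ge0_le_integralW => // u.
rewrite /patch; case: ifPn => [_|/negP uc].
  by rewrite /= -EFinM lee_fin normrM mulrC ler_wpM2r.
by rewrite /= supp ?mulr0 ?normr0// => uc'; apply: uc; rewrite inE.
Qed.

(** An [l^1] sum, convenient for adding pairings; [sum_powR_le] returns to the [l^p] sum of the
    statement at the end. *)
Definition topnorm (u : rv) : R :=
  \sum_(b : mindex n m.+1 | morder b == m.+1) `|G (mseq b) u|.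

Lemma measnneg_topnorm : measnneg topnorm.
Proof.
split=> [|u]; last by rewrite sumr_ge0.
rewrite (_ : topnorm = (fun u => \sum_(b : mindex n m.+1)
    if morder b == m.+1 then `|G (mseq b) u| else 0)); last first.
  by apply/funext => u; rewrite /topnorm big_mkcond.
apply: measurable_sum => b; case: (eqVneq (morder b) m.+1) => [bm|_]; last exact: measurable_cst.
apply: measurableT_comp => //; have bm' : (size (mseq b) <= m.+1)%N by rewrite size_mseq bm.
by case: (lintG p1 FG bm').
Qed.

Lemma topnorm_ge a i u : (\sum_j a j = m)%N -> `|G (ms (incr a i)) u| <= topnorm u.
Proof.
move=> am; pose b : mindex n m.+1 := [ffun j => inord (incr a i j)].
have bE j : b j = incr a i j :> nat.
  rewrite ffunE inordK// ltnS -am -(sum_incr a i).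
  by rewrite [leqRHS](bigD1 j)//= leq_addr.
have -> : ms (incr a i) = mseq b.
  by rewrite /mseq /ms; congr flatten; apply: eq_map => j; rewrite bE.
rewrite /topnorm (bigD1 b)/= ?lerDl ?sumr_ge0// /morder.
by rewrite (eq_bigr (incr a i)) ?sum_incr ?am// => j _; exact: bE.
Qed.

Variable x : rv.
Let h := hfun m g x.

Lemma tens_tmul_bound a phi r B u : ball x r u -> (forall u, `|tens phi u| <= B) ->
  `|tens (tmul x a phi) u| <= r ^+ (\sum_j a j)%N * B.
Proof.
move=> [r0 xu] bd; rewrite tens_tmul !normrM ler_pM// ?mulr_ge0//.
rewrite -[leRHS]mul1r ler_pM//.
  by rewrite normfV normr_nat invf_le1 ?ler1n ?ltr0n prodn_gt0// => j; exact: fact_gt0.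
rewrite normr_prod expr_sum; apply: ler_prod => j _; rewrite normr_ge0/= normrX.
rewrite lerXn2r ?nnegrE ?(ltW r0)//; have := xu ord0 j; rewrite /ball/= !mxE; exact: ltW.
Qed.

(** Only monomials of order exactly [m] survive in the weak gradient, and each is at most [r^m] on
    the cube about [x]; [#|mindex n m|] bounds their number. *)
Lemma direction_bound i phi (c : rv) (rho r B : R) : (forall j, test1 (phi j)) ->
  (forall u, ~ ball c rho u -> tens phi u = 0) -> ball c rho `<=` ball x r -> 0 < r ->
  (forall u, `|tens phi u| <= B) ->
  (`|pairing h (upd phi i (phi i)^`()%classic)|%:E <=
     (#|mindex n m|%:R * (r ^+ m * B))%:E * ballint topnorm c rho)%E.
Proof.
move=> tp supp cx r0 bd; have [mN N0] := measnneg_topnorm.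
have B0 : 0 <= B by exact: le_trans (bd 0).
rewrite (weak_derivative_hfun p1 FG gG x i tp) normrN.
apply: (@le_trans _ _ (\sum_(a : mindex n m) (r ^+ m * B)%:E * ballint topnorm c rho)%E).
  apply: (@le_trans _ _ (\sum_(a : mindex n m | morder a == m)
      `|pairing (G (ms (incr (fun j => a j) i))) (tmul x (fun j => a j) phi)|)%:E).
    by rewrite lee_fin ler_norm_sum.
  rewrite -sumEFin big_mkcond/=; apply: lee_sum => a _; case: ifPn => [am|_]; last first.
    by rewrite mule_ge0 ?ballint_ge0 ?lee_fin ?mulr_ge0 ?exprn_ge0 ?(ltW r0).
  apply: (@le_trans _ _ ((r ^+ m * B)%:E *
      ballint (fun u => `|G (ms (incr (fun j => a j) i)) u|%R) c rho)%E).
    apply: pairing_bound.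
    - by apply: (lintG p1 FG); rewrite size_ms sum_incr; move: am; rewrite /morder => /eqP->.
    - exact: test1_tmul.
    - by move=> u /supp u0; rewrite tens_tmul u0 mulr0.
    - move=> u; have [/cx xu|/supp u0] := pselect (ball c rho u).
        have := @tens_tmul_bound (fun j => a j) phi r B u xu bd.
        by rewrite -/(morder a) (eqP am).
      by rewrite tens_tmul u0 mulr0 normr0 mulr_ge0 ?exprn_ge0 ?(ltW r0).
  apply: lee_wpmul2l; first by rewrite lee_fin mulr_ge0 ?exprn_ge0 ?(ltW r0).
  apply: ge0_le_integral => //.
  - exact: measurable_rVball.
  - have [mG _] : lint (G (ms (incr (fun j => a j) i))).
      by apply: (lintG p1 FG); rewrite size_ms sum_incr; move: am; rewrite /morder => /eqP->.
    by apply/measurable_EFinP; apply: measurableT_comp => //; exact: measurable_funS mG.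
  - by apply/measurable_EFinP; exact: measurable_funS mN.
  - by move=> u _; rewrite lee_fin topnorm_ge//; apply/eqP.
rewrite -ge0_sume_distrl; last by move=> a _; rewrite lee_fin mulr_ge0 ?exprn_ge0 ?(ltW r0).
by rewrite sumEFin sumr_const mulr_natl.
Qed.

Definition avg_at (c : rv) (rho : R) : R := pairing h (fun j => psi_at (c ord0 j) rho).

Lemma test1_psi_at (b r : R) : 0 < r -> test1 (psi_at b r).
Proof.
move=> r0; split; first exact: smooth_psi_at.
exists (`|b| + r) => t bt; rewrite psi_at0//.
have := lerB_dist t b; lra.
Qed.

(** * Exchanging one tensor bump for another, coordinate by coordinate *)

Section Step.
Variables (Bp : R) (c c' : rv) (rho r : R).
Hypothesis Bp_ge : forall t : R, psi t <= Bp.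
Hypothesis rho0 : 0 < rho.
Hypothesis cc' : forall j, `|c' ord0 j - c ord0 j| <= rho.
Hypothesis cx : ball c (2 * rho) `<=` ball x r.
Hypothesis r0 : 0 < r.

Let A (j : 'I_n) := psi_at (c' ord0 j) rho.
Let B (j : 'I_n) := psi_at (c ord0 j) (2 * rho).
(** Interpolates between the two tensors: the first [k] factors already belong to the new cube. *)
Let mix (k : nat) (j : 'I_n) := if (j < k)%N then A j else B j.
(** The primitive of [A k - B k]. It has compact support because both steps go from 0 to 1 within
    distance [2 * rho] of [c ord0 k]; hence the derivative of [Phi k] in direction [k] is the
    difference of consecutive mixtures. *)
Let E (k : 'I_n) (t : R) := step_at (c' ord0 k) rho t + -1 * step_at (c ord0 k) (2 * rho) t.
Let Phi (k : 'I_n) := upd (mix k) k (E k).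

Let rho20 : 0 < 2 * rho. Proof. by rewrite mulr_gt0. Qed.

Let c_lt (j : 'I_n) (t : R) : 2 * rho <= `|t - c ord0 j| -> rho <= `|t - c' ord0 j|.
Proof.
move=> h1; have := ler_distD (c' ord0 j) t (c ord0 j); have := cc' j; lra.
Qed.

Let E0 k t : 2 * rho <= `|t - c ord0 k| -> E k t = 0.
Proof.
have := cc' k; rewrite ler_norml => /andP[h1 h2].
rewrite /E ler_normr => /orP[] h3.
  by rewrite !step_at1// ?mulr1 ?subrr//; lra.
by rewrite !step_at0// ?mulr0 ?addr0//; lra.
Qed.

Let testE k : test1 (E k).
Proof.
split.
  move=> e; apply: CkD; first exact: smooth_step_at.
  by apply: CkM; [exact: Ck_cst|exact: smooth_step_at].
exists (`|c ord0 k| + 2 * rho) => t bt; apply: E0.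
have := lerB_dist t (c ord0 k); lra.
Qed.

Let derE k t : (E k)^`()%classic t = A k t - B k t.
Proof.
rewrite derive1E; apply: derive_val.
have d1 := is_derive_step_at (c' ord0 k) rho t.
have d2 := is_deriveZ (-1) (is_derive_step_at (c ord0 k) (2 * rho) t).
by apply: (is_derive_eq (is_deriveD d1 d2)); rewrite scaleN1r.
Qed.

Let test_mix k j : test1 (mix k j).
Proof. by rewrite /mix; case: ifP => _; apply: test1_psi_at. Qed.

Let test_Phi k j : test1 (Phi k j).
Proof. exact: test1_upd. Qed.

Let mixS (k : 'I_n) :
  pairing h (mix k.+1) = pairing h (mix k) + pairing h (upd (Phi k) k (Phi k k)^`()%classic).
Proof.
rewrite (@pairingD _ _ h (mix k) (upd (Phi k) k (Phi k k)^`()%classic) _ 1) ?mul1r//.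
- by have [] := pairing_hfun p1 FG gG x (test_mix k).
- have t' := test1_upd k (test_Phi k) (test1_derive (test_Phi k k)).
  by have [] := pairing_hfun p1 FG gG x t'.
move=> u; rewrite mul1r tens_upd (tensD1 (mix k.+1) k) (tensD1 (mix k) k).
have -> : \prod_(j | j != k) mix k.+1 j (u ord0 j) = \prod_(j | j != k) mix k j (u ord0 j).
  apply: eq_bigr => j jk; rewrite /mix ltnS leq_eqVlt.
  by rewrite (_ : (j == k :> nat) = false)//; apply/negbTE.
have -> : \prod_(j | j != k) Phi k j (u ord0 j) = \prod_(j | j != k) mix k j (u ord0 j).
  by apply: eq_bigr => j jk; rewrite /Phi /upd (negbTE jk).
have -> : Phi k k = E k by rewrite /Phi /upd eqxx.
by rewrite derE /mix ltnn ltnSn; ring.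
Qed.

Let psi_at_le (b r' t : R) : rho <= r' -> `|psi_at b r' t| <= Bp / rho.
Proof.
move=> rr'; have r'0 : 0 < r' by exact: lt_le_trans rr'.
have Bp0 : 0 <= Bp by exact: le_trans (psi_ge0 0) (Bp_ge 0).
rewrite ger0_norm ?psi_at_ge0// /psi_at mulrC ler_pM ?psi_ge0 ?invr_ge0 ?(ltW r'0)//.
by rewrite lef_pV2.
Qed.

(** Factor [k] is a difference of two numbers in [[0, 1]], so only the other [n.-1] factors, bumps
    of height at most [Bp / rho], cost anything. This is the source of the power [1 - n] of the
    scale. *)
Let tens_Phi_le k u : `|tens (Phi k) u| <= (Bp / rho) ^+ n.-1.
Proof.
rewrite /Phi tens_upd normrM -[leRHS]mul1r ler_pM//.
  rewrite /E mulN1r ler_norml.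
  have := step_ge0 (rho^-1 * u ord0 k + - (c' ord0 k / rho)).
  have := step_le1 (rho^-1 * u ord0 k + - (c' ord0 k / rho)).
  have := step_ge0 ((2 * rho)^-1 * u ord0 k + - (c ord0 k / (2 * rho))).
  have := step_le1 ((2 * rho)^-1 * u ord0 k + - (c ord0 k / (2 * rho))).
  rewrite /step_at; lra.
rewrite normr_prod (_ : n.-1 = #|predC1 k|); last by rewrite cardC1 card_ord.
rewrite -prodr_const; apply: ler_prod => j _; rewrite normr_ge0/= /mix.
by case: ifP => _; apply: psi_at_le => //; rewrite ler_pMl// ler1n.
Qed.

Let Phi_supp k u : ~ ball c (2 * rho) u -> tens (Phi k) u = 0.
Proof.
move=> nu; have [j jP] : exists j, 2 * rho <= `|u ord0 j - c ord0 j|.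
  apply: contrapT => /forallNP h1; apply: nu; split=> // i j.
  by rewrite ord1 /ball/= distrC ltNge; apply/negP; exact: h1.
rewrite (tensD1 _ j) (_ : Phi k j _ = 0) ?mul0r//.
rewrite /Phi /upd; case: eqVneq => [<-|_]; first exact: E0.
rewrite /mix; case: ifP => _; first by apply: psi_at0 => //; exact: c_lt.
exact: psi_at0.
Qed.

Lemma avg_step : (`|avg_at c' rho - avg_at c (2 * rho)|%:E <=
  (n%:R * (#|mindex n m|%:R * (r ^+ m * (Bp / rho) ^+ n.-1)))%:E *
    ballint topnorm c (2 * rho))%E.
Proof.
have tele k : (k <= n)%N -> (`|pairing h (mix k) - pairing h (mix 0)|%:E <=
  (k%:R * (#|mindex n m|%:R * (r ^+ m * (Bp / rho) ^+ n.-1)))%:E *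
    ballint topnorm c (2 * rho))%E.
  have Bp0 : 0 <= Bp by exact: le_trans (psi_ge0 0) (Bp_ge 0).
  have K0 : 0 <= #|mindex n m|%:R * (r ^+ m * (Bp / rho) ^+ n.-1).
    by rewrite !mulr_ge0// exprn_ge0 ?divr_ge0 ?(ltW r0) ?(ltW rho0).
  elim: k => [|k IH] kn; first by rewrite subrr normr0 mul0r mul0e.
  have := mixS (Ordinal kn); rewrite /= => ->.
  rewrite -natr1 mulrDl mul1r EFinD.
  rewrite ge0_muleDl; [|by rewrite lee_fin (mulr_ge0 (ler0n _ k))|by rewrite lee_fin].
  apply: (@le_trans _ _ (`|pairing h (mix k) - pairing h (mix 0)|%:E +
    `|pairing h (upd (Phi (Ordinal kn)) (Ordinal kn)
        (Phi (Ordinal kn) (Ordinal kn))^`()%classic)|%:E)%E).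
    by rewrite -EFinD lee_fin addrAC ler_normD.
  apply: leeD; first exact: IH (ltnW kn).
  by apply: direction_bound => //; exact: Phi_supp.
have := tele n (leqnn n).
rewrite (_ : mix n = A); last by apply/funext => j; rewrite /mix ltn_ord.
by rewrite (_ : mix 0 = B).
Qed.

End Step.

End Averages.

(** * The pointwise estimate *)

Lemma continuous_bigsum (R : realType) (T : topologicalType) (I : Type) (r : seq I)
    (P : pred I) (f : I -> T -> R) : (forall i, P i -> continuous (f i)) ->
  continuous (fun u => \sum_(i <- r | P i) f i u).
Proof.
move=> cf; elim: r => [|i r IH] u.
  have -> : (fun u => \sum_(i <- [::] | P i) f i u) = cst 0.
    by apply/funext => v; rewrite big_nil.
  exact: cst_continuous.
have [Pi|Pi] := boolP (P i); last first.
  have -> : (fun u => \sum_(j <- i :: r | P j) f j u) = (fun u => \sum_(j <- r | P j) f j u).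
    by apply/funext => v; rewrite big_cons (negbTE Pi).
  exact: IH.
have -> : (fun u => \sum_(j <- i :: r | P j) f j u) =
    f i \+ (fun u => \sum_(j <- r | P j) f j u).
  by apply/funext => v; rewrite big_cons Pi.
by apply: continuousD; [exact: cf|exact: IH].
Qed.

Section Pointwise.
Variables (R : realType) (n m : nat) (p : R) (F : 'rV[R]_n -> R)
  (G g : seq 'I_n -> 'rV[R]_n -> R).
Hypothesis p1 : 1 <= p.
Hypothesis FG : weak_sobolev m.+1 p F G.
Hypothesis gG : forall s, (size s <= m)%N -> continuous (g s) /\ rn_ae_eq (g s) (G s).
Local Notation rv := 'rV[R]_n.
Local Notation mu := (mun R n).
Variable x : rv.
Let h := hfun m g x.
Local Notation avg := (avg_at m g x).

Lemma continuous_hfun : continuous h.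
Proof.
have c1 (a : mindex n m) : (morder a <= m)%N -> continuous
    (fun u : rv => (mfact a)%:R^-1 * g (mseq a) u * mpow a (x - u)).
  move=> am u; have -> : (fun u : rv => (mfact a)%:R^-1 * g (mseq a) u * mpow a (x - u)) =
      (cst ((mfact a)%:R^-1) \* g (mseq a)) \* tens (fun j t => (x ord0 j - t) ^+ a j).
    by apply/funext => v; congr (_ * _); apply: eq_bigr => j _; rewrite !mxE.
  apply: continuousM.
    apply: continuousM; first exact: cst_continuous.
    by have [cg _] : _ /\ _ := gG (s := mseq a) (eq_ind_r (fun k => k <= m)%N am (size_mseq a)); exact: cg.
  by apply: continuous_tens => j; apply: smooth_continuous => k; exact: Ck_pow.
exact: continuous_bigsum c1.
Qed.

Lemma lint_cst (c : R) : lint (fun _ : rv => c).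
Proof.
split=> [|r r0]; first exact: measurable_cst.
rewrite integral_cst; last exact: measurable_rVball.
apply: (@le_lt_trans _ _ (`|c|%:E * ((2 * r) ^+ n)%:E)%E); last by rewrite -EFinM ltry.
by rewrite -(mun_ball (0 : rv) r0).
Qed.

(** An approximate identity: the tensor bump is nonnegative, has unit mass and vanishes outside
    [ball y rho], where [h] is close to [h y] by continuity. *)
Lemma avg_limit (y : rv) (e : R) : 0 < e ->
  exists2 d : R, 0 < d & forall rho, 0 < rho -> rho < d -> `|avg y rho - h y| <= e.
Proof.
move=> e0; have /cvgrPdist_lt/(_ e e0) := continuous_hfun (x := y).
move=> /nbhs_ballP[d /= d0 dP]; exists d => // rho rho0 rd.
pose phi j := psi_at (y ord0 j) rho.
have tp j : test1 (phi j) by exact: test1_psi_at.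
have ph0 u : 0 <= tens phi u by apply: prodr_ge0 => j _; exact: psi_at_ge0.
have i1 := (pairing_hfun p1 FG gG x tp).1.
have i2 (c : R) := integrable_tens (lint_cst c) tp.
have I1 (c : R) : \int[mu]_u (c * tens phi u) = c.
  have i3 : mu.-integrable setT (EFin \o (fun u : borelRn R n => tens phi u)).
    have -> : (fun u : borelRn R n => tens phi u) = (fun u => 1 * tens phi u).
      by apply/funext => u; rewrite mul1r.
    exact: i2.
  rewrite RintegralZl// /Rintegral integral_tens ?mulr1//.
  - move=> j; apply: continuous_measurable_fun.
    exact: smooth_continuous (smooth_psi_at _ _).
  - by move=> j t; exact: psi_at_ge0.
  - by move=> j; exact: integral_psi_at.
rewrite -(I1 (h y)) /avg_at /pairing -RintegralB//.
have i3 : mu.-integrable setT (EFin \o (fun u : borelRn R n => h u * tens phi u - h y * tens phi u)).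
  exact: integrableB i1 (i2 _).
apply: (le_trans (le_normr_Rintegral _ i3)) => //.
rewrite -[leRHS](I1 e); apply: le_Rintegral => //.
  exact: integrable_abse i3.
move=> u _; rewrite -mulrBl normrM (ger0_norm (ph0 u)).
have [yu|yu] := pselect (ball y rho u).
  by rewrite ler_wpM2r// distrC ltW//; apply: dP; apply: le_ball yu; exact: ltW.
suff -> : tens phi u = 0 by rewrite !mulr0.
have [j jP] : exists j, rho <= `|u ord0 j - y ord0 j|.
  apply: contrapT => /forallNP h1; apply: yu; split=> // i j.
  by rewrite ord1 /ball/= distrC ltNge; apply/negP; exact: h1.
by rewrite (tensD1 _ j) /phi psi_at0 ?mul0r.
Qed.

End Pointwise.

(** A substitute for Hölder's inequality: pointwise, either [v <= l] or [v <= l^(1-q) * v^q]. The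
    level [l] stays free so that the two terms can be balanced later. *)
Lemma young_ball (R : realType) n (v : 'rV[R]_n -> R) (q l : R) (c : 'rV[R]_n) (rho : R) :
  1 <= q -> 0 < l -> 0 < rho -> measnneg v ->
  (ballint v c rho <= (l * (2 * rho) ^+ n)%:E +
     (l / l `^ q)%:E * ballint (fun u => (v u `^ q)%R) c rho)%E.
Proof.
move=> q1 l0 rho0 [mv v0].
have mb := @measurable_rVball R n c rho.
have mq (D : set (borelRn R n)) : measurable_fun D (fun u : borelRn R n => (v u `^ q)%:E).
  apply/measurable_EFinP; apply: (measurableT_comp (measurable_powR q)).
  exact: measurable_funS mv.
have ll : 0 <= l / l `^ q by rewrite divr_ge0 ?powR_ge0 ?(ltW l0).
rewrite EFinM -(mun_ball c rho0) -integral_cst// /ballint -ge0_integralZl//;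
  last by move=> u _; rewrite lee_fin powR_ge0.
rewrite -ge0_integralD//; last 3 first.
- by move=> u _; rewrite lee_fin ltW.
- by move=> u _; rewrite -EFinM lee_fin mulr_ge0 ?powR_ge0.
- exact: measurable_funeM.
apply: ge0_le_integral => //.
- by move=> u _; rewrite lee_fin.
- by apply/measurable_EFinP; exact: measurable_funS mv.
- by apply: emeasurable_funD => //; exact: measurable_funeM.
move=> u _; rewrite /= -EFinM -EFinD lee_fin.
have [ul|ul] := leP (v u) l.
  by rewrite (le_trans ul)// lerDl mulr_ge0 ?powR_ge0.
apply: (@le_trans _ _ (l / l `^ q * v u `^ q)); last by rewrite lerDr ltW.
have a1 : 1 <= v u / l by rewrite ler_pdivlMr// mul1r ltW.
have vE : v u = l * (v u / l) by rewrite mulrCA divff ?mulr1// gt_eqF.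
rewrite {2}vE powRM ?(ltW l0)//; last exact: le_trans ler01 a1.
rewrite mulrA divfK; last by rewrite gt_eqF// powR_gt0.
by rewrite {1}vE ler_pM2l// le1r_powR.
Qed.

(** * The dyadic chain of cubes from [x] to [y] *)

Section Chain.
Variables (R : realType) (n m : nat) (p : R) (F : 'rV[R]_n -> R)
  (G g : seq 'I_n -> 'rV[R]_n -> R).
Hypothesis p1 : 1 <= p.
Hypothesis FG : weak_sobolev m.+1 p F G.
Hypothesis gG : forall s, (size s <= m)%N -> continuous (g s) /\ rn_ae_eq (g s) (G s).
Hypothesis n0 : (0 < n)%N.
Variables (q Bp : R).
Hypothesis nq : n%:R < q.
Hypothesis Bp_ge : forall t : R, psi t <= Bp.
Local Notation rv := 'rV[R]_n.
Local Notation N := (topnorm m G).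

(** Halving a cube divides its volume by [2^n], so the available bound on the [q]-mean of [N] grows
    by [L]. One factor of the side length gains 2, whence the ratio [L / 2], below 1 exactly because
    [n < q]. *)
Let L : R := 2 `^ (n%:R / q).
Definition chain_ratio : R := L / 2.
(** Directions, multi-indices, heights of the [n.-1] bumps (2 because the bound at radius [rad k.+1]
    is rewritten with [rad k]), and the constant of [ballintN]. *)
Definition chain_cst : R :=
  n%:R * #|mindex n m|%:R * (2 * Bp) ^+ n.-1 * (2 * 4 ^+ n).

Let q1 : 1 <= q.
Proof. by apply: le_trans (ltW nq); rewrite ler1n. Qed.

Let q0 : 0 < q. Proof. exact: lt_le_trans ltr01 q1. Qed.

Let L0 : 0 < L. Proof. exact: powR_gt0. Qed.

Let Lq : L `^ q = 2 ^+ n.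
Proof. by rewrite /L -powRrM divfK ?gt_eqF// powR_mulrn. Qed.

Lemma chain_ratio_gt0 : 0 < chain_ratio.
Proof. by rewrite divr_gt0. Qed.

Lemma chain_ratio_lt1 : chain_ratio < 1.
Proof.
rewrite ltr_pdivrMr// mul1r /L /powR pnatr_eq0/= -[ltRHS]lnK ?posrE// ltr_expR.
by rewrite gtr_pMl ?ln_gt0 ?ltr1n// ltr_pdivrMr// mul1r.
Qed.

Lemma chain_cst_ge0 : 0 <= chain_cst.
Proof.
have Bp0 : 0 <= Bp by exact: le_trans (psi_ge0 0) (Bp_ge 0).
by rewrite /chain_cst !mulr_ge0 ?exprn_ge0 ?mulr_ge0.
Qed.

Variables (x y : rv) (D W : R).
Hypothesis D0 : 0 < D.
Hypothesis W0 : 0 < W.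
Hypothesis xy : forall j, `|y ord0 j - x ord0 j| <= D / 2.
Hypothesis MW : (maxfun (fun u => (N u `^ q)%R) x <= (W `^ q)%:E)%E.

Local Notation avg := (avg_at m g x).
Let h := hfun m g x.
(** Only the first step moves the centre. As [y] is within [D / 2] of [x] in each coordinate, every
    later cube, of radius at most [D / 2], stays inside [ball x D], where the maximal function at
    [x] applies. *)
Let cen (k : nat) : rv := if k is 0 then x else y.
Let rad (k : nat) : R := D / 2 ^+ k.

Let rad0 k : 0 < rad k. Proof. by rewrite divr_gt0 ?exprn_gt0. Qed.

Let radS k : rad k = 2 * rad k.+1.
Proof. by rewrite /rad exprS; field; rewrite expf_neq0. Qed.

Let cen_step k j : `|cen k.+1 ord0 j - cen k ord0 j| <= rad k.+1.
Proof.
case: k => [|k] /=; first by rewrite /rad expr1.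
by rewrite subrr normr0 ltW.
Qed.

Let rad_le k : rad k.+1 <= D / 2.
Proof.
rewrite /rad ler_pM2l// lef_pV2 ?posrE ?exprn_gt0// exprS ler_peMr//.
by rewrite exprn_ege1// ler1n.
Qed.

Let cen_sub k : ball (cen k) (rad k) `<=` ball x D.
Proof.
case: k => [|k]; first by rewrite /rad expr0 divr1.
move=> u [_ yu]; split=> // i j; have := yu i j; rewrite ord1 /ball/= => h1.
have := ler_distD (y ord0 j) (x ord0 j) (u ord0 j).
have h2 := xy j; rewrite distrC in h2; have := rad_le k.
move: h1 h2 => /=; lra.
Qed.

Let measN : measnneg (fun u => N u `^ q).
Proof.
have [mN _] := measnneg_topnorm p1 FG; split=> [|u]; last exact: powR_ge0.
exact: (measurableT_comp (measurable_powR q)).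
Qed.

(** The level [l = L^k * W] balances [young_ball]: [l^q = 2^(n k) * W^q] turns the bound
    [(4 D)^n * W^q] on the big cube into [l * (4 * rad k)^n], comparable with the other term. *)
Let ballintN k : (ballint N (cen k) (rad k) <= (L ^+ k * W * (2 * 4 ^+ n) * rad k ^+ n)%:E)%E.
Proof.
pose l := L ^+ k * W.
have l0 : 0 < l by rewrite mulr_gt0 ?exprn_gt0.
have Lk0 : 0 < L ^+ k by rewrite exprn_gt0.
have lq : l `^ q = (2 ^+ n) ^+ k * W `^ q.
  rewrite powRM ?(ltW Lk0) ?(ltW W0)//; congr (_ * _).
  by rewrite -powR_mulrn ?(ltW L0)// -powRrM mulrC powRrM Lq powR_mulrn.
apply: (le_trans (young_ball _ q1 l0 (rad0 k) (measnneg_topnorm p1 FG))).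
have h1 : (ballint (fun u => (N u `^ q)%R) (cen k) (rad k) <= ((4 * D) ^+ n * W `^ q)%:E)%E.
  apply: (le_trans (le_ballint measN (@cen_sub k))).
  apply: (le_trans (ballint_le_maxfun x measN D0)).
  by rewrite EFinM lee_wpmul2l// lee_fin exprn_ge0// mulr_ge0// ltW.
apply: (@le_trans _ _ ((l * (2 * rad k) ^+ n)%:E + (l / l `^ q)%:E * ((4 * D) ^+ n * W `^ q)%:E)%E).
  by rewrite leeD2l// lee_wpmul2l// lee_fin divr_ge0 ?powR_ge0// ltW.
rewrite -EFinM -EFinD lee_fin -/l.
have -> : l / l `^ q * ((4 * D) ^+ n * W `^ q) = l * (4 * rad k) ^+ n.
  rewrite lq /rad mulrA (mulrA 4) [in RHS]expr_div_n exprAC.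
  by field; rewrite expf_neq0 ?expf_neq0// gt_eqF ?powR_gt0.
have -> : l * (2 * 4 ^+ n) * rad k ^+ n = l * (4 * rad k) ^+ n + l * (4 * rad k) ^+ n.
  rewrite (exprMn _ 4); set X := 4 ^+ n; set Y := rad k ^+ n; ring.
rewrite lerD2r ler_pM2l//; apply: lerXn2r; rewrite ?nnegrE; move: (rad0 k);
  set t := rad k; lra.
Qed.

Let theta := chain_ratio.

(** The bumps cost [rad k] to the power [1 - n] and the integral supplies [rad k ^+ n]. The
    remaining factor [D / 2^k] meets [D^m] from the monomials and [L^k] from the level. *)
Let step k : `|avg (cen k.+1) (rad k.+1) - avg (cen k) (rad k)| <=
  chain_cst * D ^+ m.+1 * W * theta ^+ k.
Proof.
have Bp0 : 0 <= Bp by exact: le_trans (psi_ge0 0) (Bp_ge 0).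
have csub : ball (cen k) (2 * rad k.+1) `<=` ball x D by rewrite -radS; exact: cen_sub.
have := avg_step p1 FG gG Bp_ge (rad0 k.+1) (cen_step k) csub D0.
rewrite -radS -lee_fin => /le_trans; apply.
set C1 := n%:R * _.
have C10 : 0 <= C1.
  by rewrite /C1 !mulr_ge0// exprn_ge0 ?divr_ge0 ?(ltW D0) ?(ltW (rad0 _)).
apply: (le_trans (lee_wpmul2l _ (ballintN k))); first by rewrite lee_fin.
rewrite -EFinM lee_fin /C1 /chain_cst /theta /chain_ratio le_eqVlt; apply/orP; left; apply/eqP.
have -> : Bp / rad k.+1 = 2 * Bp / rad k.
  by rewrite (radS k); field; rewrite gt_eqF.
rewrite (expr_div_n (2 * Bp)) (expr_div_n L) [rad k ^+ n](_ : _ = rad k * rad k ^+ n.-1); last first.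
  by rewrite -exprS prednK.
have r0 : rad k ^+ n.-1 != 0 by rewrite expf_neq0// gt_eqF.
move: r0; set Z := rad k ^+ n.-1 => Z0; rewrite /rad exprS.
by field; rewrite Z0 expf_neq0.
Qed.

Let chain k : `|avg (cen k) (rad k) - avg x D| <=
  chain_cst * D ^+ m.+1 * W * \sum_(i < k) theta ^+ i.
Proof.
elim: k => [|k IH]; first by rewrite /= /rad expr0 divr1 subrr normr0 big_ord0 mulr0.
rewrite big_ord_recr/= mulrDr.
apply: (le_trans (ler_distD (avg (cen k) (rad k)) _ _)).
by rewrite [leLHS]addrC; apply: lerD; [exact: IH|exact: step].
Qed.

Lemma chain_bound : `|h y - avg x D| <= chain_cst / (1 - theta) * D ^+ m.+1 * W.
Proof.
apply/ler_addgt0Pr => e e0.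
have [d d0 dP] := avg_limit p1 FG gG x y e0.
pose k := (Num.bound (D / d)).+1.
have kd : rad k < d.
  rewrite /rad ltr_pdivrMr ?exprn_gt0// mulrC -ltr_pdivrMr//.
  apply: (lt_le_trans (archi_boundP _)); first by rewrite divr_ge0 ?(ltW D0) ?(ltW d0).
  by rewrite -natrX ler_nat (leq_trans (leqnSn _))// ltnW// ltn_expl.
have := dP _ (rad0 k) kd; rewrite distrC => h1.
apply: (le_trans (ler_distD (avg (cen k) (rad k)) _ _)); rewrite addrC; apply: lerD => //.
apply: (le_trans (chain k)).
have t1 : 0 < 1 - theta by rewrite subr_gt0 chain_ratio_lt1.
have -> : chain_cst / (1 - theta) * D ^+ m.+1 * W = chain_cst * D ^+ m.+1 * W / (1 - theta).
  by ring.
rewrite ler_wpM2l//.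
  apply: mulr_ge0 (ltW W0); apply: mulr_ge0 chain_cst_ge0 _.
  by rewrite exprn_ge0// ltW.
rewrite -[leRHS]mul1r ler_pdivlMr//.
have -> : (\sum_(i < k) theta ^+ i) * (1 - theta) = 1 - theta ^+ k.
  have e1 := subrX1 theta k; rewrite -[RHS]opprB e1; ring.
by rewrite gerBl exprn_ge0// ltW// chain_ratio_gt0.
Qed.

End Chain.

(** * The maximal inequality *)

Section Assembly.
Variable R : realType.

Lemma enorm_ge0 n (x : 'rV[R]_n) : 0 <= enorm x.
Proof. exact: sqrtr_ge0. Qed.

Lemma coord_le_enorm n (x : 'rV[R]_n) j : `|x ord0 j| <= enorm x.
Proof.
rewrite -sqrtr_sqr ler_wsqrtr// (bigD1 j)//= lerDl.
by apply: sumr_ge0 => i _; exact: sqr_ge0.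
Qed.

Lemma enorm_gt0 n (x y : 'rV[R]_n) : x <> y -> 0 < enorm (x - y).
Proof.
move=> xy; rewrite lt_neqAle enorm_ge0 andbT eq_sym; apply/eqP => e0; apply: xy.
apply/rowP => j; apply/eqP; rewrite -subr_eq0 -normr_le0.
by have := coord_le_enorm (x - y) j; rewrite e0 !mxE.
Qed.

(** Each term is at most the [p]-th root of the sum of [p]-th powers; this crude bound needs only
    [p > 0]. *)
Lemma sum_powR_le (I : finType) (P : pred I) (f : I -> R) (p : R) : 0 < p ->
  (forall i, 0 <= f i) ->
  (\sum_(i | P i) f i) `^ p <= #|I|%:R `^ p * \sum_(i | P i) f i `^ p.
Proof.
move=> p0 f0; set T := \sum_(i | P i) f i `^ p.
have T0 : 0 <= T by apply: sumr_ge0 => i _; exact: powR_ge0.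
have le1 i : P i -> f i <= T `^ p^-1.
  move=> Pi; have -> : f i = (f i `^ p) `^ p^-1.
    by rewrite -powRrM divff ?gt_eqF// powRr1.
  apply: ge0_ler_powR; rewrite ?nnegrE ?powR_ge0 ?invr_ge0 ?(ltW p0)//.
  by rewrite /T (bigD1 i)//= lerDl sumr_ge0// => j _; exact: powR_ge0.
have le2 : \sum_(i | P i) f i <= #|I|%:R * T `^ p^-1.
  rewrite mulr_natl -sumr_const big_mkcond/=; apply: ler_sum => i _.
  by case: ifP => [/le1//|_]; exact: powR_ge0.
apply: (@le_trans _ _ ((#|I|%:R * T `^ p^-1) `^ p)).
  by apply: ge0_ler_powR; rewrite ?nnegrE ?sumr_ge0 ?mulr_ge0 ?powR_ge0 ?(ltW p0).
by rewrite powRM ?powR_ge0// -[in X in _ * X <= _]powRrM mulVf ?gt_eqF// powRr1.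
Qed.

Lemma Mop_le n m (p q Bp : R) (F : 'rV[R]_n -> R) (G g : seq 'I_n -> 'rV[R]_n -> R)
    (K : set 'rV[R]_n) (x : 'rV[R]_n) :
  1 <= p -> (0 < n)%N -> n%:R < q -> (forall t : R, psi t <= Bp) ->
  weak_sobolev m.+1 p F G ->
  (forall s, (size s <= m)%N -> continuous (g s) /\ rn_ae_eq (g s) (G s)) ->
  (Mop m.+1 K g x <=
    (2 * (chain_cst n m Bp / (1 - chain_ratio n q)) * 2 ^+ m.+1 + 1)%:E *
    poweR (maxfun (fun u => (topnorm m G u `^ q)%R) x) q^-1)%E.
Proof.
move=> p1 n0 nq Bp_ge FG gG; set Ck := _ / (1 - _).
have q0 : 0 < q by exact: le_lt_trans nq.
have Bp0 : 0 <= Bp by exact: le_trans (psi_ge0 0) (Bp_ge 0).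
have Ck0 : 0 <= Ck.
  rewrite divr_ge0 ?(chain_cst_ge0 n m Bp_ge)// subr_ge0 ltW//.
  exact: chain_ratio_lt1.
(* The summand 1 makes [K'] positive at once, for the division by [K'] below and for the case of an
   infinite maximal function. *)
set K' := 2 * Ck * _ + 1; have K'0 : 0 < K'.
  by apply: ltr_wpDl => //; apply: mulr_ge0; [exact: mulr_ge0|exact: exprn_ge0].
have measN : measnneg (fun u => topnorm m G u `^ q).
  have [mN _] := measnneg_topnorm p1 FG; split=> [|u]; last exact: powR_ge0.
  exact: (measurableT_comp (measurable_powR q)).
have M0 := maxfun_ge0 x measN.
apply: ge_ereal_sup => _ [->|[y [z [_ _ yz ->]]]].
  by rewrite mule_ge0 ?poweR_ge0// lee_fin ltW.
(* The chain is run with [D = 2 * r], so that both base points are within [D / 2] of [x] and end in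
   the same average. *)
pose r := Num.max (enorm (x - y)) (enorm (x - z)).
set E := enorm (x - y) ^+ m.+1 + enorm (x - z) ^+ m.+1.
have r0 : 0 < r.
  rewrite lt_max; have [xy|xy] := pselect (x = y); last by rewrite enorm_gt0.
  by apply/orP; right; apply: enorm_gt0; rewrite xy.
have rE : r ^+ m.+1 <= E.
  rewrite /E /r; case: (leP (enorm (x - y)) (enorm (x - z))) => _; first by rewrite lerDr exprn_ge0 ?enorm_ge0.
  by rewrite lerDl exprn_ge0 ?enorm_ge0.
have E0 : 0 < E by apply: lt_le_trans rE; rewrite exprn_gt0.
have xyr j : `|y ord0 j - x ord0 j| <= 2 * r / 2.
  rewrite mulrC mulKf// distrC le_max.
  by have := coord_le_enorm (x - y) j; rewrite !mxE => ->.
have xzr j : `|z ord0 j - x ord0 j| <= 2 * r / 2.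
  rewrite mulrC mulKf// distrC le_max.
  by have := coord_le_enorm (x - z) j; rewrite !mxE => ->; rewrite orbT.
have r20 : 0 < 2 * r by rewrite mulr_gt0.
have key W : 0 < W -> (maxfun (fun u => (topnorm m G u `^ q)%R) x <= (W `^ q)%:E)%E ->
    `|taylor m.+1 g y x - taylor m.+1 g z x| / E <= K' * W.
  move=> W0 MW; rewrite ler_pdivrMr//.
  have by_ := chain_bound p1 FG gG n0 nq Bp_ge r20 W0 xyr MW.
  have bz := chain_bound p1 FG gG n0 nq Bp_ge r20 W0 xzr MW.
  apply: (le_trans (ler_distD (avg_at m g x x (2 * r)) _ _)).
  rewrite [X in _ + X]distrC; apply: (le_trans (lerD by_ bz)); rewrite -/Ck exprMn.
  have -> : Ck * (2 ^+ m.+1 * r ^+ m.+1) * W + Ck * (2 ^+ m.+1 * r ^+ m.+1) * W =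
    (2 * Ck * 2 ^+ m.+1 * W) * r ^+ m.+1 by ring.
  apply: (@le_trans _ _ ((2 * Ck * 2 ^+ m.+1 * W) * E)).
    apply: ler_wpM2l rE; apply: mulr_ge0 (ltW W0).
    by apply: mulr_ge0; [exact: mulr_ge0|exact: exprn_ge0].
  by rewrite ler_pM2r// ler_pM2r// lerDl.
move: M0 key; case: (maxfun _ x) => [w||] //.
- rewrite lee_fin => w0 key; rewrite poweR_EFin -EFinM lee_fin.
  (* The chain needs a positive [W], while the maximal function may vanish; its root is enlarged by
     [e / K'], which costs exactly [e]. *)
  apply/ler_addgt0Pr => e e0.
  have eK : 0 < e / K' by rewrite divr_gt0.
  have W0 : 0 < w `^ q^-1 + e / K' by rewrite ltr_wpDl ?powR_ge0.
  apply: (le_trans (key _ W0 _)).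
    rewrite lee_fin -[w in leLHS](@powRr1 _ w)// -(@mulVf _ q) ?gt_eqF// powRrM.
    by apply: ge0_ler_powR; rewrite ?nnegrE ?powR_ge0 ?(ltW q0) ?(ltW W0)// lerDl ltW.
  by rewrite mulrDr (mulrC K' (_ / _)) divfK// gt_eqF.
- by move=> _ _; rewrite poweRyr ?invr_eq0 ?gt_eqF// gt0_muley ?leey// lte_fin.
Qed.

End Assembly.

Theorem mainTheorem15 (R : realType) (n m : nat) (p : R) :
  (1 <= m)%N -> n%:R < p ->
  exists C : R, 0 < C /\
  forall (K : set 'rV[R]_n) (F : 'rV[R]_n -> R)
         (G g : seq 'I_n -> 'rV[R]_n -> R),
    compact K ->
    weak_sobolev m p F G ->
    (forall s : seq 'I_n, (size s <= m.-1)%N ->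
        continuous (g s) /\ rn_ae_eq (g s) (G s)) ->
    (iint (fun x => poweR (Mop m K g x) p)
      <= C%:E * iint (fun x =>
           (\sum_(a : mindex n m | morder a == m) `|G (mseq a) x| `^ p)%:E))%E.
Proof.
case: m => // m _ np; have p0 : 0 < p by exact: le_lt_trans np.
have [n0|n0] := posnP n.
  (* In dimension 0 all points coincide, so no pair [y <> z] exists and [Mop] is 0. *)
  move: np; rewrite {}n0 => np; exists 1; split=> // K F G g _ _ _; rewrite mul1e /=.
  rewrite (_ : Mop _ _ _ _ = 0%E).
    by rewrite poweR0r ?gt_eqF// lee_fin sumr_ge0// => a _; exact: powR_ge0.
  rewrite /Mop (_ : [set e | _] = set0) ?setU0 ?ereal_sup1//.
  by apply/seteqP; split=> // e [y [z [_ _ yz _]]]; apply: yz; rewrite (thinmx0 y) (thinmx0 z).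
have p1 : 1 <= p by apply: le_trans (ltW np); rewrite ler1n.
pose q := (n%:R + p) / 2.
have nq : n%:R < q by rewrite /q; lra.
have qp : q < p by rewrite /q; lra.
have q0 : 0 < q by exact: le_lt_trans nq.
have s1 : 1 < p / q by rewrite ltr_pdivlMr// mul1r.
have [B B0 BP] := psi_bounded R.
have [Cm Cm0 CM] := maxfun_strong s1 n.
set K' := 2 * (chain_cst n m B / (1 - chain_ratio n q)) * 2 ^+ m.+1 + 1.
have K'0 : 0 < K'.
  apply: ltr_wpDl => //; apply: mulr_ge0; last exact: exprn_ge0.
  apply: mulr_ge0 => //; apply: mulr_ge0; first exact: (chain_cst_ge0 n m BP).
  by rewrite invr_ge0 subr_ge0 ltW// chain_ratio_lt1.
pose c := #|mindex n m.+1|%:R `^ p : R.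
have c0 : 0 < c by rewrite powR_gt0// ltr0n; apply/card_gt0P; exists [ffun=> ord0].
(* The three factors come from [Mop_le], from the maximal theorem with exponent [p / q], and from
   the passage from the [l^1] to the [l^p] sum. *)
exists (K' `^ p * Cm * c); split; first by rewrite !mulr_gt0// powR_gt0.
move=> K F G g _ FG gG.
pose v u := topnorm m G u `^ q.
have [mN N0] := measnneg_topnorm p1 FG.
have mv : measnneg v.
  split=> [|u]; last exact: powR_ge0.
  exact: (measurableT_comp (measurable_powR q)).
apply: (@le_trans _ _ (iint (fun x => (K' `^ p)%:E * poweR (maxfun v x) (p / q))%E)).
  have M0 x : (0 <= Mop m.+1 K g x)%E.
    by apply: ereal_sup_ubound; left.
  have := @le_iint R n (fun x => poweR (Mop m.+1 K g x) p)
    (fun x => (K' `^ p)%:E * poweR (maxfun v x) (p / q))%E.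
  move=> /(_ (fun x => poweR_ge0 _ _)) h; suff /h/andP[] : forall x,
    (poweR (Mop m.+1 K g x) p <= (K' `^ p)%:E * poweR (maxfun v x) (p / q))%E by [].
  move=> x; have Mle := Mop_le K x p1 n0 nq BP FG gG.
  rewrite [p / q]mulrC poweRrM -poweR_EFin -poweRM ?poweR_ge0 ?lee_fin ?(ltW K'0)//.
  apply: gt0_ler_poweR Mle; first exact: ltW.
    by rewrite in_itv/= leey andbT.
  by rewrite in_itv/= leey andbT mule_ge0 ?poweR_ge0// lee_fin ltW.
have mM : measurable_fun setT (fun x : borelRn R n => poweR (maxfun v x) (p / q)).
  apply: (measurableT_comp (measurable_poweR (p / q))); exact: measurable_maxfun.
rewrite iintE; first last.
- by move=> x; rewrite mule_ge0 ?poweR_ge0// lee_fin powR_ge0.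
- exact: measurable_funeM.
rewrite ge0_integralZl//; [|by move=> x _; exact: poweR_ge0|by rewrite lee_fin powR_ge0].
rewrite -!mulrA EFinM -muleA; apply: lee_wpmul2l; first by rewrite lee_fin powR_ge0.
apply: (le_trans (CM v mv)); rewrite EFinM -muleA; apply: lee_wpmul2l.
  by rewrite lee_fin ltW.
have mG (a : mindex n m.+1) : morder a == m.+1 ->
    measurable_fun setT (fun u : borelRn R n => `|G (mseq a) u| `^ p).
  move=> /eqP am; apply: (measurableT_comp (measurable_powR p)).
  apply: measurableT_comp => //; have am' : (size (mseq a) <= m.+1)%N by rewrite size_mseq am.
  by case: (lintG p1 FG am').
have mS : measurable_fun setT (fun u : borelRn R n =>
    (\sum_(a : mindex n m.+1 | morder a == m.+1) `|G (mseq a) u| `^ p)%:E).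
  apply/measurable_EFinP; rewrite (_ : (fun _ => _) = (fun u : borelRn R n =>
    \sum_(a : mindex n m.+1) if morder a == m.+1 then `|G (mseq a) u| `^ p else 0)).
    apply: measurable_sum => a.
    case: (boolP (morder a == m.+1)) => [am|_]; last exact: measurable_cst.
    exact: mG.
  by apply/funext => u; rewrite big_mkcond.
rewrite iintE//; last by move=> u; rewrite lee_fin sumr_ge0// => a _; exact: powR_ge0.
rewrite -ge0_integralZl//; first last.
- by rewrite lee_fin ltW.
- by move=> u _; rewrite lee_fin sumr_ge0// => a _; exact: powR_ge0.
apply: ge0_le_integralW => u; first by rewrite lee_fin powR_ge0.
rewrite -EFinM lee_fin /v -powRrM mulrC divfK ?gt_eqF//.
exact: sum_powR_le.
Qed.
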